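(* Consider the linear model $Y=X\beta+\epsilon$ described in the context, with $S=\mathrm{supp}(\beta)$, $s=|S|$, and $s_0,T_0,A_0,a_0,\beta_{\min,A_0}$, $\lambda=\sqrt{2\log p/n}$ as defined there. Suppose that $RE(s_0,6,X)$ holds, and that $\Lambda_{\min}(2s)>0$ and $\Lambda_{\max}(2s)<\infty$. Let $a\ge0$, choose $\lambda_n\ge b\,\lambda_{\sigma,a,p}$ with $b\ge2$, write $\lambda_n=d_0\lambda\sigma$, and let $\beta_{\rm init}$ be the Lasso estimator with parameter $\lambda_n$. Let $D_0,D_1$ be the constants in the context, and suppose that for some constant $\breve D_1\ge D_1$, $$\beta_{\min,A_0}\ \ge\ D_0\lambda\sigma\sqrt{s_0}+\breve D_1\lambda\sigma .$$ Choose a thresholding parameter $t_0$ and set $$I=\{j:|\beta_{j,\rm init}|\ge t_0\},\qquad\text{where } t_0\ge\breve D_1\lambda\sigma .$$ Let $\mathcal D=\{1,\dots,p\}\setminus I$ and $\hat\beta_I=(X_I^TX_I)^{-1}X_I^TY$ (extended by $0$ outside $I$). Then on $\mathcal T_a$: $$A_0\subset I,\qquad |I\cap T_0^c|\le s_0,\qquad\text{and hence } |I|\le2s_0;\qquad \|\beta_{\mathcal D}\|_2^2\le(s_0-a_0)\lambda^2\sigma^2;$$ $$\|\hat\beta_I-\beta\|_2^2\le\frac{C_7\,s_0\lambda^2\sigma^2}{\Lambda_{\min}^2(|I|)}\quad\text{with}\quad C_7\le\Lambda_{\min}^2(|I|)+\frac{(\Lambda_{\max}(2s)-\Lambda_{\min}(2s))^2}{2}+4(1+a).$$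 Moreover, on $\mathcal T_a$, where $|I|\le2s_0$, $$\frac{\|X\hat\beta_I-X\beta\|_2}{\sqrt n}\le C_8\sqrt{s_0}\,\lambda\sigma,\qquad C_8=\sqrt{\Lambda_{\max}(s)}+\frac{\sqrt{2(1+a)\Lambda_{\max}(|I|)}}{\Lambda_{\min}(|I|)} .$$
   Context: Model. $p\ge n$; $X$ is a fixed real $n\times p$ matrix whose columns all have $\ell_2$ norm $\sqrt n$; $\beta\in\mathbb R^p$; $\epsilon\sim N(0,\sigma^2I_n)$ with $\sigma>0$; $Y=X\beta+\epsilon$; $\mathrm{supp}(\beta)=\{j:\beta_j\ne0\}$. For $T\subseteq\{1,\dots,p\}$, $X_T$ is the submatrix of columns indexed by $T$, $v_T$ the restriction of $v$ to $T$, and $T^c$ the complement of $T$ in $\{1,\dots,p\}$. The coordinates are ordered so that $|\beta_1|\ge|\beta_2|\ge\dots\ge|\beta_p|$ (labelling only; the procedure does not use it). $s_0$ is the smallest integer with $\sum_{i=1}^p\min(\beta_i^2,\lambda^2\sigma^2)\le s_0\lambda^2\sigma^2$; $T_0=\{1,\dots,s_0\}$; $A_0=\{j:|\beta_j|>\lambda\sigma\}=\{1,\dots,a_0\}$ (a subset of $T_0$); $\beta_{\min,A_0}=\min_{j\le a_0}|\beta_j|$. Event. $\lambda_{\sigma,a,p}=\sigma\sqrt{1+a}\sqrt{2\log p/n}$ and $\mathcal T_a=\{\epsilon:\|X^T\epsilon/n\|_\infty\le\lambda_{\sigma,a,p}\}$. ''On $\mathcal T_a$'' means for every realization $\epsilon\in\mathcal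 T_a$. Lasso with parameter $\lambda_n$: minimize $\frac1{2n}\|Y-Xb\|_2^2+\lambda_n\|b\|_1$ over $b\in\mathbb R^p$. $\Lambda_{\min}(m)$, $\Lambda_{\max}(m)$: minimum and maximum of $\|Xv\|_2^2/(n\|v\|_2^2)$ over nonzero $v$ with at most $m$ nonzero entries (convention $\Lambda_{\max}(0)=0$). $\theta_{m,m'}$: smallest number with $|\langle X_Tc,X_{T'}c'\rangle|/n\le\theta_{m,m'}\|c\|_2\|c'\|_2$ for all disjoint $T,T'$ with $|T|\le m$, $|T'|\le m'$ and all $c,c'$. $RE(m,k_0,X)$ for an integer $m\geq 1$: $\frac1{K(m,k_0)}:=\min_{|J_0|\le m}\min_{v\ne0,\,\|v_{J_0^c}\|_1\le k_0\|v_{J_0}\|_1}\frac{\|Xv\|_2}{\sqrt n\|v_{J_0}\|_2}>0$. Constants, with $K=K(s_0,6)$: $$D=(\sqrt2+1)\frac{\sqrt{\Lambda_{\max}(s-s_0)}}{\sqrt{\Lambda_{\min}(2s_0)}}+\frac{\theta_{s_0,2s_0}\Lambda_{\max}(s-s_0)}{\Lambda_{\min}(2s_0)},\qquad D_0=\max\bigl\{D,\ K\sqrt2\,(2\sqrt{\Lambda_{\max}(s-s_0)}+3d_0K)\bigr\},$$ $$D_1=\frac{2\Lambda_{\max}(s-s_0)}{d_0}+\frac{9K^2d_0}{2}.$$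
   Formalization: As stated, a very large t_0 makes I empty, so all claims but |I∩T_0^c|≤s_0 and |I|≤2s_0 are proved under the added condition β_{min,A_0} ≥ D_0λσ√s_0 + t_0 (automatic for t_0 = D̆_1λσ); Λ_min(0), undefined in the text, is taken to be 1. *)

(* Defs.v *)
From HB Require Import structures.
From mathcomp Require Export all_boot all_order all_algebra.
From mathcomp Require Export all_classical all_reals all_analysis.
Export Order.TTheory GRing.Theory Num.Theory.
Export numFieldNormedType.Exports.

Set Implicit Arguments.
Unset Strict Implicit.
Unset Printing Implicit Defensive.

Local Open Scope classical_set_scope.
Local Open Scope ring_scope.

Section Vectors.
Context {R : realType}.

Definition l1norm {p} (v : 'cV[R]_p) : R := \sum_j `|v j 0|.

Definition l2norm {p} (v : 'cV[R]_p) : R := Num.sqrt (\sum_j v j 0 ^+ 2).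

Definition inner {n} (u v : 'cV[R]_n) : R := (u^T *m v) 0 0.

Definition supp {p} (v : 'cV[R]_p) : {set 'I_p} := [set j | v j 0 != 0]%SET.

(* X_T and v_T, with the indices of T listed by enum_val. *)
Definition subcols {n p} (X : 'M[R]_(n, p)) (T : {set 'I_p}) : 'M[R]_(n, #|T|) :=
  colsub (fun k : 'I_#|T| => enum_val k) X.

Definition subvec {p} (T : {set 'I_p}) (v : 'cV[R]_p) : 'cV[R]_#|T| :=
  rowsub (fun k : 'I_#|T| => enum_val k) v.

(* subcols 1%:M T is the coordinate embedding of R^T into R^p. *)
Definition extend0 {p} (T : {set 'I_p}) (c : 'cV[R]_#|T|) : 'cV[R]_p :=
  subcols 1%:M T *m c.

End Vectors.

Section Design.
Context {R : realType} {n p : nat}.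
Variable X : 'M[R]_(n, p).

Definition sparse_rayleigh (m : nat) : set R :=
  [set l2norm (X *m v) ^+ 2 / (n%:R * l2norm v ^+ 2)
     | v in [set v : 'cV[R]_p | v != 0 /\ (#|supp v| <= m)%N]].

(* At m = 0 the set is empty and sup set0 = 0. *)
Definition Lambda_max (m : nat) : R := sup (sparse_rayleigh m).

(* There is no nonzero vector to minimize over at m = 0.  The value 1 is that
   of Lambda_min 1 when the columns of X have norm sqrt n. *)
Definition Lambda_min (m : nat) : R :=
  if m == 0%N then 1 else inf (sparse_rayleigh m).

Definition theta (m m' : nat) : R :=
  inf [set t : R | forall T T' : {set 'I_p},
         [disjoint T & T']%B -> (#|T| <= m)%N -> (#|T'| <= m')%N ->
         forall (c : 'cV[R]_#|T|) (c' : 'cV[R]_#|T'|),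
           `|inner (subcols X T *m c) (subcols X T' *m c')| / n%:R
             <= t * l2norm c * l2norm c'].

Definition RE_cone (k0 : R) (J : {set 'I_p}) : set 'cV[R]_p :=
  [set v | v != 0 /\ l1norm (subvec (~: J) v) <= k0 * l1norm (subvec J v)].

(* 1 / K(m, k0).  Vectors of the cone have v_J != 0, so no quotient is 0 / 0. *)
Definition RE_invconst (m : nat) (k0 : R) : R :=
  inf [set r : R | exists J : {set 'I_p}, (#|J| <= m)%N /\
         exists2 v, RE_cone k0 J v &
           r = l2norm (X *m v) / (Num.sqrt n%:R * l2norm (subvec J v))].

Definition RE_const (m : nat) (k0 : R) : R := (RE_invconst m k0)^-1.

Definition RE (m : nat) (k0 : R) : Prop := (1 <= m)%N /\ 0 < RE_invconst m k0.

Definition D_const (s s0 : nat) : R :=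
  (Num.sqrt 2 + 1) * (Num.sqrt (Lambda_max (s - s0))
                      / Num.sqrt (Lambda_min (2 * s0)))
  + theta s0 (2 * s0) * Lambda_max (s - s0) / Lambda_min (2 * s0).

Definition D0_const (s s0 : nat) (d0 : R) : R :=
  let K := RE_const s0 6 in
  Num.max (D_const s s0)
    (K * Num.sqrt 2 * (2 * Num.sqrt (Lambda_max (s - s0)) + 3 * d0 * K)).

Definition D1_const (s s0 : nat) (d0 : R) : R :=
  2 * Lambda_max (s - s0) / d0 + 9 * RE_const s0 6 ^+ 2 * d0 / 2.

Definition lasso_obj (Y : 'cV[R]_n) (lambda_n : R) (b : 'cV[R]_p) : R :=
  l2norm (Y - X *m b) ^+ 2 / (2 * n%:R) + lambda_n * l1norm b.

Definition is_lasso (Y : 'cV[R]_n) (lambda_n : R) (b : 'cV[R]_p) : Prop :=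
  forall b' : 'cV[R]_p, lasso_obj Y lambda_n b <= lasso_obj Y lambda_n b'.

Definition ols (I : {set 'I_p}) (Y : 'cV[R]_n) : 'cV[R]_p :=
  let XI := subcols X I in extend0 (invmx (XI^T *m XI) *m XI^T *m Y).

Definition noise_event (tau : R) : set 'cV[R]_n :=
  [set e | forall j : 'I_p, `|((n%:R)^-1 *: (X^T *m e)) j 0| <= tau].

End Design.

Section Signal.
Context {R : realType} {p : nat}.
Variable beta : 'cV[R]_p.

(* In this section tau stands for lambda * sigma. *)
Definition sparsity_bound (tau : R) (m : nat) : Prop :=
  \sum_j Num.min (beta j 0 ^+ 2) (tau ^+ 2) <= m%:R * tau ^+ 2.

Definition is_s0 (tau : R) (s0 : nat) : Prop :=
  sparsity_bound tau s0 /\ forall m, sparsity_bound tau m -> (s0 <= m)%N.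

Definition first_coords (m : nat) : {set 'I_p} := [set j : 'I_p | (j < m)%N]%SET.

Definition large_coords (tau : R) : {set 'I_p} :=
  [set j | tau < `|beta j 0|]%SET.

(* A minimum over the empty set is +oo. *)
Definition beta_min (A : {set 'I_p}) : \bar R :=
  \big[Order.min/+oo%E]_(j in A) (`|beta j 0|%:E).

Definition threshold_set (t0 : R) : {set 'I_p} :=
  [set j | t0 <= `|beta j 0|]%SET.

End Signal.

(* eps ~ N(0, sigma^2 I_n): the coordinates are random variables whose joint
   law is the n-fold product of N(0, sigma^2), expressed on measurable boxes.
   The parameter sigma of normal_prob is the standard deviation. *)
Definition gaussian_noise {R : realType} {d : measure_display}
    {Omega : measurableType d} (P : probability Omega R) (n : nat)
    (sigma : R) (eps : Omega -> 'cV[R]_n) : Prop :=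
  (forall i, measurable_fun [set: Omega] (fun w => eps w i 0)) /\
  forall B : 'I_n -> set (measurableTypeR R), (forall i, measurable (B i)) ->
    P [set w | forall i, B i (eps w i 0)]
      = (\prod_(i < n) normal_prob 0 sigma (B i))%E.

(* Main.v *)
Require Import Defs.
From mathcomp Require Import ring lra.

(* Let h be the difference of the Lasso estimator and beta_T0, and let delta be
   beta off T0, so that ||delta||^2 <= s0 (lambda sigma)^2.  On the noise event,
   optimality against beta_T0 gives the basic inequality
     A^2 + lambda_n |h_T0c|_1 <= B^2 + 3 lambda_n |h_T0|_1,
   with A = ||X(h - delta)|| / sqrt n and B = ||X delta|| / sqrt n.  If the last term
   dominates B^2, then h lies in the cone of RE(s0, 6); otherwise A^2 <= 2 B^2,
   and the shelling argument with theta bounds h on T0.  Either way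
     ||h_T0||_2 <= D0 lambda sigma sqrt s0  and  |h_T0c|_1 <= D1 lambda sigma s0,
   so thresholding keeps A0 and at most s0 coordinates outside T0.  The least
   squares bounds then follow from the normal equations, the inner product
   <Xu, X beta_D> being controlled by polarization on the at most 2 s coordinates
   of I and S. *)

Set Implicit Arguments.
Unset Strict Implicit.
Unset Printing Implicit Defensive.

Local Open Scope classical_set_scope.
Local Open Scope ring_scope.

(** * Euclidean inner product and norm *)

Section Vectors.
Context {R : realType}.

Lemma innerE n (u v : 'cV[R]_n) : inner u v = \sum_i u i 0 * v i 0.
Proof. by rewrite /inner mxE; apply: eq_bigr => i _; rewrite mxE. Qed.

Lemma innerC n (u v : 'cV[R]_n) : inner u v = inner v u.
Proof. by rewrite !innerE; apply: eq_bigr => i _; rewrite mulrC. Qed.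

Lemma innerDr n (u v w : 'cV[R]_n) : inner u (v + w) = inner u v + inner u w.
Proof. by rewrite /inner mulmxDr mxE. Qed.

Lemma innerNr n (u v : 'cV[R]_n) : inner u (- v) = - inner u v.
Proof. by rewrite /inner mulmxN mxE. Qed.

Lemma innerBr n (u v w : 'cV[R]_n) : inner u (v - w) = inner u v - inner u w.
Proof. by rewrite innerDr innerNr. Qed.

Lemma innerDl n (u v w : 'cV[R]_n) : inner (u + v) w = inner u w + inner v w.
Proof. by rewrite innerC innerDr !(innerC w). Qed.

Lemma innerNl n (u v : 'cV[R]_n) : inner (- u) v = - inner u v.
Proof. by rewrite innerC innerNr innerC. Qed.

Lemma innerBl n (u v w : 'cV[R]_n) : inner (u - v) w = inner u w - inner v w.
Proof. by rewrite innerC innerBr !(innerC w). Qed.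

Lemma innerZr n a (u v : 'cV[R]_n) : inner u (a *: v) = a * inner u v.
Proof. by rewrite /inner -scalemxAr mxE. Qed.

Lemma innerZl n a (u v : 'cV[R]_n) : inner (a *: u) v = a * inner u v.
Proof. by rewrite innerC innerZr innerC. Qed.

Lemma inner_mulmxl n p (X : 'M[R]_(n, p)) u w :
  inner (X *m u) w = inner u (X^T *m w).
Proof. by rewrite /inner trmx_mul mulmxA. Qed.

Lemma l2norm_ge0 n (v : 'cV[R]_n) : 0 <= l2norm v.
Proof. exact: sqrtr_ge0. Qed.

Lemma sqr_l2norm n (v : 'cV[R]_n) : l2norm v ^+ 2 = inner v v.
Proof.
rewrite sqr_sqrtr; last by apply: sumr_ge0 => j _; exact: sqr_ge0.
by rewrite innerE; apply: eq_bigr => i _; rewrite expr2.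
Qed.

Lemma sqr_l2normE n (v : 'cV[R]_n) : l2norm v ^+ 2 = \sum_i v i 0 ^+ 2.
Proof. by rewrite sqr_l2norm innerE; apply: eq_bigr => i _; rewrite expr2. Qed.

Lemma l2norm0 n : l2norm (0 : 'cV[R]_n) = 0.
Proof. by apply/eqP; rewrite -sqrf_eq0 sqr_l2norm /inner mulmx0 mxE. Qed.

Lemma ler_coord_l2norm n (v : 'cV[R]_n) i : `|v i 0| <= l2norm v.
Proof.
rewrite -(@ler_pXn2r _ 2) ?nnegrE ?l2norm_ge0// sqr_l2normE real_normK ?num_real//.
by rewrite (bigD1 i)//= lerDl; apply: sumr_ge0 => j _; exact: sqr_ge0.
Qed.

Lemma l2norm_eq0 n (v : 'cV[R]_n) : (l2norm v == 0) = (v == 0).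
Proof.
apply/idP/idP => [/eqP v0|/eqP ->]; last by rewrite l2norm0.
apply/eqP/colP => i; rewrite mxE; apply/normr0_eq0/eqP.
by rewrite eq_le normr_ge0 -v0 ler_coord_l2norm.
Qed.

Lemma l2norm_gt0 n (v : 'cV[R]_n) : (0 < l2norm v) = (v != 0).
Proof. by rewrite lt_def l2norm_ge0 andbT l2norm_eq0. Qed.

(** The square of the norm of [l2norm v *: u - l2norm u *: v] expands to twice [l2norm u * l2norm v]
    times the gap between the two sides. *)
Lemma cauchy_schwarz n (u v : 'cV[R]_n) : inner u v <= l2norm u * l2norm v.
Proof.
have [->|u0] := eqVneq u 0; first by rewrite l2norm0 mul0r innerC /inner mulmx0 mxE.
have [->|v0] := eqVneq v 0; first by rewrite l2norm0 mulr0 /inner mulmx0 mxE.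
have uv_gt0 : 0 < l2norm u * l2norm v by rewrite mulr_gt0// l2norm_gt0.
have := sqr_ge0 (l2norm (l2norm v *: u - l2norm u *: v)).
rewrite sqr_l2norm !(innerBr, innerBl, innerZr, innerZl) -!sqr_l2norm (innerC v u).
set x := l2norm u in uv_gt0 *; set y := l2norm v in uv_gt0 *.
by move=> ?; rewrite -(ler_pM2l uv_gt0); lra.
Qed.

Lemma ler_norm_inner n (u v : 'cV[R]_n) : `|inner u v| <= l2norm u * l2norm v.
Proof.
rewrite ler_norml cauchy_schwarz andbT lerNl -innerNr.
apply: le_trans (cauchy_schwarz _ _) _; rewrite ler_wpM2l ?l2norm_ge0//.
by rewrite -(@ler_pXn2r _ 2) ?nnegrE ?l2norm_ge0// !sqr_l2normE;
  apply: ler_sum => i _; rewrite mxE sqrrN.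
Qed.

Lemma l2norm_triangle n (u v : 'cV[R]_n) : l2norm (u + v) <= l2norm u + l2norm v.
Proof.
rewrite -(@ler_pXn2r _ 2) ?nnegrE ?addr_ge0 ?l2norm_ge0//.
rewrite sqr_l2norm innerDl !innerDr -!sqr_l2norm (innerC v u) sqrrD.
by have := cauchy_schwarz u v; lra.
Qed.

End Vectors.

(** * Supports and restriction to a set of coordinates *)

Section Restriction.
Context {R : realType} {p : nat}.
Implicit Types (T U : {set 'I_p}) (u v : 'cV[R]_p).

(** Unlike [subvec], the result stays in R^p: pieces of a vector can be added, and the same [X] acts
    on all of them. *)
Definition restr T v : 'cV[R]_p := \col_j (if j \in T then v j 0 else 0).

Lemma supp_sub T v : reflect (forall j, j \notin T -> v j 0 = 0) (supp v \subset T).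
Proof.
apply: (iffP fintype.subsetP) => [vT j jT|vT j].
  by apply/eqP; apply: contraNT jT => vj; apply: vT; rewrite inE.
by rewrite inE; apply: contraNT => /vT ->.
Qed.

Lemma supp_restr T v : supp (restr T v) \subset T.
Proof. by apply/supp_sub => j /negPf jT; rewrite mxE jT. Qed.

Lemma supp_restrI T v : supp (restr T v) \subset T :&: supp v.
Proof.
by apply/supp_sub => j; rewrite !inE negb_and negbK mxE => /orP[/negPf->//|/eqP->];
  rewrite if_same.
Qed.

Lemma supp_subD u v T : supp u \subset T -> supp v \subset T -> supp (u + v) \subset T.
Proof.
by move=> /supp_sub uT /supp_sub vT; apply/supp_sub => j jT; rewrite mxE uT ?vT ?addr0.
Qed.

Lemma supp_subN v T : supp v \subset T -> supp (- v) \subset T.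
Proof. by move=> /supp_sub vT; apply/supp_sub => j jT; rewrite mxE vT ?oppr0. Qed.

Lemma supp_subZ a v T : supp v \subset T -> supp (a *: v) \subset T.
Proof. by move=> /supp_sub vT; apply/supp_sub => j jT; rewrite mxE vT ?mulr0. Qed.

Lemma restr_id T v : supp v \subset T -> restr T v = v.
Proof.
by move=> /supp_sub vT; apply/colP => j; rewrite mxE; case: ifPn => // /vT ->.
Qed.

Lemma restrU T U v : [disjoint T & U]%B -> restr (T :|: U) v = restr T v + restr U v.
Proof.
move=> TU; apply/colP => j; rewrite !mxE inE.
case: (boolP (j \in T)) => [/(disjointFr TU)->|_]; first by rewrite addr0.
by rewrite add0r.
Qed.

Lemma restrC T v : v = restr T v + restr (~: T) v.
Proof.
by apply/colP => j; rewrite !mxE inE; case: (j \in T); rewrite /= ?addr0 ?add0r.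
Qed.

Lemma sqr_l2norm_restr T v : l2norm (restr T v) ^+ 2 = \sum_(j in T) v j 0 ^+ 2.
Proof.
rewrite sqr_l2normE [RHS]big_mkcond; apply: eq_bigr => j _.
by rewrite mxE; case: ifP => // _; rewrite expr0n.
Qed.

Lemma l2norm_restr_sub T U v : T \subset U ->
  l2norm (restr T v) <= l2norm (restr U v).
Proof.
move=> TU; rewrite -(@ler_pXn2r _ 2) ?nnegrE ?l2norm_ge0// !sqr_l2norm_restr.
rewrite [leRHS](finset.big_setID T) (finset.setIidPr TU) lerDl.
by apply: sumr_ge0 => j _; exact: sqr_ge0.
Qed.

Lemma inner_disjoint u v T U : supp u \subset T -> supp v \subset U ->
  [disjoint T & U]%B -> inner u v = 0.
Proof.
move=> /supp_sub uT /supp_sub vU TU; rewrite innerE big1// => j _.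
case: (boolP (j \in T)) => [/(disjointFr TU)/negbT/vU->|/uT->].
  by rewrite mulr0.
by rewrite mul0r.
Qed.

Lemma l1norm_subvec T v : l1norm (subvec T v) = \sum_(j in T) `|v j 0|.
Proof. by rewrite big_enum_val; apply: eq_bigr => k _; rewrite mxE. Qed.

Lemma l2norm_subvec T v : l2norm (subvec T v) = l2norm (restr T v).
Proof.
apply/eqP; rewrite -(@eqrXn2 _ 2) ?l2norm_ge0// sqr_l2norm_restr sqr_l2normE.
by rewrite [X in _ == X]big_enum_val; apply/eqP/eq_bigr => k _; rewrite mxE.
Qed.

(** Cauchy-Schwarz between the indicator vector of [T] and the absolute values of [v] on [T]. *)
Lemma ler_l1_l2 T v : \sum_(j in T) `|v j 0| <= Num.sqrt #|T|%:R * l2norm (restr T v).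
Proof.
pose w : 'cV[R]_p := \col_j `|v j 0|; pose e : 'cV[R]_p := const_mx 1.
have <- : inner (restr T e) (restr T w) = \sum_(j in T) `|v j 0|.
  rewrite innerE [RHS]big_mkcond; apply: eq_bigr => j _; rewrite !mxE.
  by case: ifP; rewrite ?mul1r ?mul0r.
apply: le_trans (cauchy_schwarz _ _) _.
have -> : l2norm (restr T w) = l2norm (restr T v).
  apply/eqP; rewrite -(@eqrXn2 _ 2) ?l2norm_ge0// !sqr_l2norm_restr; apply/eqP.
  by apply: eq_bigr => j _; rewrite mxE real_normK ?num_real.
rewrite ler_wpM2r ?l2norm_ge0// -(@ler_pXn2r _ 2) ?nnegrE ?l2norm_ge0 ?sqrtr_ge0//.
rewrite sqr_l2norm_restr sqr_sqrtr ?ler0n// -sumr_const.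
by apply: ler_sum => j _; rewrite mxE expr1n.
Qed.

End Restriction.

(** * Column submatrices and extension by zero *)

Section Columns.
Context {R : realType} {n p : nat}.
Variable X : 'M[R]_(n, p).
Implicit Types (T : {set 'I_p}).

Lemma subcolsE T : subcols X T = X *m subcols 1%:M T.
Proof.
apply/matrixP => i k; rewrite -[X in LHS]mulmx1 !mxE.
by apply: eq_bigr => j _; rewrite !mxE.
Qed.

Lemma extend0E T (c : 'cV[R]_#|T|) : X *m extend0 c = subcols X T *m c.
Proof. by rewrite subcolsE -mulmxA. Qed.

(** With [extend0E], this trades column submatrices for [X] itself acting on full-length vectors
    supported in [T]. *)
Lemma extend0_subvec T (v : 'cV[R]_p) : extend0 (subvec T v) = restr T v.
Proof.
apply/colP => j; rewrite !mxE.
under eq_bigr do rewrite !mxE.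
rewrite -(big_enum_val (fun k => (j == k)%:R * v k 0)) /=.
case: ifPn => jT.
  rewrite (bigD1 j)//= eqxx mul1r big1 ?addr0// => k /andP[_ /negPf].
  by rewrite eq_sym => ->; rewrite mul0r.
by rewrite big1// => k kT; case: eqP jT => [->|]; rewrite ?kT ?mul0r.
Qed.

Lemma subcols_subvec T v : subcols X T *m subvec T v = X *m restr T v.
Proof. by rewrite -extend0E extend0_subvec. Qed.

Lemma supp_extend0 T (c : 'cV[R]_#|T|) : supp (extend0 c) \subset T.
Proof.
apply/supp_sub => j jT; rewrite mxE big1// => k _; rewrite !mxE.
by case: eqP jT => [->|]; rewrite ?enum_valP ?mul0r.
Qed.

Lemma extend0K T : cancel (@extend0 R p T) (subvec T).
Proof.
move=> c; apply/colP => k; rewrite !mxE (bigD1 k)//= !mxE eqxx mul1r big1 ?addr0// => l lk.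
by rewrite !mxE (inj_eq enum_val_inj) eq_sym (negPf lk) mul0r.
Qed.

Lemma l2norm_extend0 T (c : 'cV[R]_#|T|) : l2norm (extend0 c) = l2norm c.
Proof. by rewrite -[in RHS](extend0K c) l2norm_subvec restr_id ?supp_extend0. Qed.

End Columns.

(** * Sparse eigenvalues, restricted orthogonality, restricted eigenvalues *)

Section DesignConstants.
Context {R : realType} {n p : nat}.
Variable X : 'M[R]_(n, p).
Hypothesis n_gt0 : (0 < n)%N.

Let nR_gt0 : 0 < n%:R :> R.
Proof. by rewrite ltr0n. Qed.

(** Only finiteness matters: it bounds the Rayleigh quotients from above and makes the set of
    admissible constants in [theta] nonempty. The value comes from [r i], the l1 norm of row [i]. *)
Lemma gram_bound : exists C : R, forall u v : 'cV[R]_p,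
  `|inner (X *m u) (X *m v)| <= C * l2norm u * l2norm v.
Proof.
pose r i : R := \sum_j `|X i j|.
have Xr v i : `|(X *m v) i 0| <= r i * l2norm v.
  rewrite mxE /r mulr_suml; apply: le_trans (ler_norm_sum _ _ _) _.
  by apply: ler_sum => j _; rewrite normrM ler_wpM2l// ler_coord_l2norm.
exists (\sum_i r i ^+ 2) => u v; rewrite innerE -mulrA mulr_suml.
apply: le_trans (ler_norm_sum _ _ _) _; apply: ler_sum => i _.
by rewrite normrM expr2 mulrACA ler_pM.
Qed.

Lemma sparse_rayleigh_ge0 m : lbound (sparse_rayleigh X m) 0.
Proof. by move=> _ [v _ <-]; rewrite divr_ge0 ?mulr_ge0 ?l2norm_ge0 ?ler0n. Qed.

Lemma sparse_rayleigh_ub m : has_ubound (sparse_rayleigh X m).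
Proof.
have [C CP] := gram_bound; exists (C / n%:R) => _ [v [v0 _] <-].
rewrite -[X in _ <= X]divr1 ler_pdivrMr ?mulr_gt0 ?exprn_gt0 ?l2norm_gt0//.
rewrite divr1 mulrA mulfVK ?gt_eqF// sqr_l2norm.
by apply: le_trans (ler_norm _) _; rewrite expr2 mulrA.
Qed.

Lemma l2norm_mulmx_le_Lambda_max m (v : 'cV[R]_p) : (#|supp v| <= m)%N ->
  l2norm (X *m v) ^+ 2 / n%:R <= Lambda_max X m * l2norm v ^+ 2.
Proof.
have [->|v0 vm] := eqVneq v 0; first by rewrite mulmx0 !l2norm0 expr0n/= mul0r mulr0.
have v_gt0 : 0 < l2norm v ^+ 2 by rewrite exprn_gt0 ?l2norm_gt0.
rewrite -ler_pdivrMr// -mulrA -invfM; apply: ub_le_sup; first exact: sparse_rayleigh_ub.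
by exists v.
Qed.

Lemma l2norm_mulmx_ge_Lambda_min m (v : 'cV[R]_p) : (#|supp v| <= m)%N ->
  Lambda_min X m * l2norm v ^+ 2 <= l2norm (X *m v) ^+ 2 / n%:R.
Proof.
have [->|v0 vm] := eqVneq v 0; first by rewrite mulmx0 !l2norm0 expr0n/= mul0r mulr0.
have v_gt0 : 0 < l2norm v ^+ 2 by rewrite exprn_gt0 ?l2norm_gt0.
rewrite -ler_pdivlMr// -mulrA -invfM /Lambda_min; case: eqP => [m0|_].
  (* The default value at [m = 0] does no harm: an empty support contradicts [v != 0]. *)
  case/eqP: v0; apply/colP => j; rewrite mxE; apply/eqP/negPn/negP => vj.
  by move: vm; rewrite m0 leqn0 cards_eq0 => /eqP/setP/(_ j); rewrite !inE vj.
by apply: ge_inf; [exists 0; exact: sparse_rayleigh_ge0|exists v].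
Qed.

Lemma supp_le1 (j : 'I_p) : (#|supp (delta_mx j 0%R : 'cV[R]_p)| <= 1)%N.
Proof.
rewrite -[X in (_ <= X)%N](cards1 j); apply/subset_leq_card/supp_sub => i.
by rewrite inE mxE eqxx andbT => /negPf ->.
Qed.

Lemma delta_neq0 (j : 'I_p) : (delta_mx j 0 : 'cV[R]_p) != 0.
Proof.
apply/eqP => /colP/(_ j); rewrite !mxE !eqxx => /eqP.
by rewrite oner_eq0.
Qed.

Lemma Lambda_max_ge0 m : 0 <= Lambda_max X m.
Proof.
have [[r rS]|S0] := pselect (sparse_rayleigh X m !=set0).
  apply: le_trans (sparse_rayleigh_ge0 rS) _.
  exact: ub_le_sup (sparse_rayleigh_ub m) _ rS.
by rewrite /Lambda_max sup_out// => -[].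
Qed.

(** One coordinate vector tests both constants. At [m = 0] the conventions 1 and 0 would reverse the
    inequality. *)
Lemma Lambda_min_le_max m : (0 < p)%N -> (0 < m)%N -> Lambda_min X m <= Lambda_max X m.
Proof.
move=> p0 m0; have jm := leq_trans (supp_le1 (Ordinal p0)) m0.
have := le_trans (l2norm_mulmx_ge_Lambda_min jm) (l2norm_mulmx_le_Lambda_max jm).
by rewrite ler_pM2r ?exprn_gt0 ?l2norm_gt0 ?delta_neq0.
Qed.

(** A larger sparsity level allows more vectors, so the infimum drops. Comparing the infima also
    takes a member of the smaller set, here a coordinate vector. *)
Lemma Lambda_min_mono k m : (0 < p)%N -> (0 < k <= m)%N ->
  Lambda_min X m <= Lambda_min X k.
Proof.
move=> p0 /andP[k0 km]; rewrite /Lambda_min gtn_eqF ?(leq_trans k0)// gtn_eqF//.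
apply: lb_le_inf.
  pose j := Ordinal p0; pose v : 'cV[R]_p := delta_mx j 0.
  exists (l2norm (X *m v) ^+ 2 / (n%:R * l2norm v ^+ 2)).
  by exists v => //; split; [exact: delta_neq0|exact: leq_trans (supp_le1 j) k0].
move=> r [v [v0 vk] <-]; apply: ge_inf; first by exists 0; exact: sparse_rayleigh_ge0.
by exists v => //; split=> //; exact: leq_trans km.
Qed.

(** Every admissible [t] is at least the normalized inner product, hence so is their infimum;
    [gram_bound] supplies one admissible [t]. *)
Lemma inner_le_theta m m' (T T' : {set 'I_p}) u v :
  [disjoint T & T']%B -> (#|T| <= m)%N -> (#|T'| <= m')%N ->
  supp u \subset T -> supp v \subset T' ->
  `|inner (X *m u) (X *m v)| / n%:R <= theta X m m' * l2norm u * l2norm v.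
Proof.
move=> TT' Tm Tm' uT vT'.
have [->|u0] := eqVneq u 0.
  by rewrite mulmx0 innerC /inner mulmx0 mxE normr0 l2norm0 mulr0 !mul0r.
have [->|v0] := eqVneq v 0.
  by rewrite mulmx0 /inner mulmx0 mxE normr0 l2norm0 mulr0 !mul0r.
rewrite -mulrA -ler_pdivrMr ?mulr_gt0 ?l2norm_gt0//; apply: lb_le_inf.
  have [C CP] := gram_bound; exists (C / n%:R) => S S' _ _ _ c c'.
  rewrite -!extend0E ler_pdivrMr//; apply: le_trans (CP _ _) _.
  rewrite !l2norm_extend0 le_eqVlt; apply/orP; left; apply/eqP; field.
  exact: lt0r_neq0.
move=> t /(_ _ _ TT' Tm Tm' (subvec T u) (subvec T' v)).
rewrite !subcols_subvec !l2norm_subvec !restr_id// -(mulrA t) => H.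
by rewrite ler_pdivrMr ?mulr_gt0 ?l2norm_gt0.
Qed.

(** Two distinct coordinates give disjoint index sets carrying nonzero vectors, which rule out
    negative constants; hence [1 < p]. *)
Lemma theta_ge0 m m' : (1 < p)%N -> (0 < m)%N -> (0 < m')%N -> 0 <= theta X m m'.
Proof.
move=> p1 m0 m'0; pose i := Ordinal (ltnW p1); pose j := Ordinal p1.
have := @inner_le_theta m m' [set i]%SET [set j]%SET (delta_mx i 0) (delta_mx j 0).
rewrite disjoints1 inE !cards1 => /(_ erefl m0 m'0) H.
have dsupp (k : 'I_p) : supp (delta_mx k 0 : 'cV[R]_p) \subset [set k]%SET.
  by apply/supp_sub => l; rewrite inE mxE => /negPf ->.
have := le_trans _ (H (dsupp i) (dsupp j)).
move=> /(_ 0); rewrite divr_ge0 ?normr_ge0 ?ler0n// -mulrA => /(_ isT).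
by rewrite pmulr_lge0// mulr_gt0// l2norm_gt0 delta_neq0.
Qed.

Lemma RE_l2norm m k0 (J : {set 'I_p}) v : RE X m k0 -> (#|J| <= m)%N ->
  l1norm (subvec (~: J) v) <= k0 * l1norm (subvec J v) ->
  l2norm (restr J v) <= RE_const X m k0 * (l2norm (X *m v) / Num.sqrt n%:R).
Proof.
move=> [_ RE0] Jm cone; rewrite /RE_const.
have K0 : 0 <= (RE_invconst X m k0)^-1 by rewrite invr_ge0 ltW.
have [->|Jv0] := eqVneq (restr J v) 0.
  by rewrite l2norm0 mulr_ge0// divr_ge0 ?sqrtr_ge0 ?l2norm_ge0.
rewrite mulrC ler_pdivlMr// mulrC -ler_pdivlMr ?l2norm_gt0// -mulrA -invfM.
rewrite -l2norm_subvec; apply: ge_inf.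
  exists 0 => _ [J' [_ [v' _ ->]]].
  by rewrite divr_ge0 ?mulr_ge0 ?sqrtr_ge0 ?l2norm_ge0.
exists J; split=> //; exists v => //; split=> //.
by apply: contraNneq Jv0 => ->; apply/eqP/colP => j; rewrite !mxE if_same.
Qed.

Lemma inner_le_Lambda_gap m (T T' : {set 'I_p}) u v :
  [disjoint T & T']%B -> (#|T :|: T'| <= m)%N ->
  supp u \subset T -> supp v \subset T' ->
  inner (X *m u) (X *m v) / n%:R
    <= (Lambda_max X m - Lambda_min X m) / 2 * (l2norm u * l2norm v).
Proof.
move=> TT' Tm uT vT'.
have [->|u0] := eqVneq u 0.
  by rewrite mulmx0 innerC /inner mulmx0 mxE l2norm0 !mul0r mulr0.
have [->|v0] := eqVneq v 0.
  by rewrite mulmx0 /inner mulmx0 mxE l2norm0 !mulr0 !mul0r.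
have xy_gt0 : 0 < l2norm u * l2norm v by rewrite mulr_gt0 ?l2norm_gt0.
have uU : supp u \subset T :|: T' by apply: fintype.subset_trans uT (finset.subsetUl _ _).
have vU : supp v \subset T :|: T' by apply: fintype.subset_trans vT' (finset.subsetUr _ _).
have sp (w : 'cV[R]_p) : supp w \subset T :|: T' -> (#|supp w| <= m)%N.
  by move=> wU; exact: leq_trans (subset_leq_card wU) Tm.
(* Polarization of the vectors of equal norm ||v|| u and ||u|| v. *)
have u'U := supp_subZ (l2norm v) uU; have v'U := supp_subZ (l2norm u) vU.
have := l2norm_mulmx_le_Lambda_max (sp _ (supp_subD u'U v'U)).
have := l2norm_mulmx_ge_Lambda_min (sp _ (supp_subD u'U (supp_subN v'U))).
rewrite !mulmxDr mulmxN -!scalemxAr !sqr_l2norm.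
rewrite !(innerDr, innerDl, innerNr, innerNl, innerZr, innerZl) -!sqr_l2norm.
rewrite !(innerC v u) !(innerC (X *m v) (X *m u)) (inner_disjoint uT vT' TT').
move: xy_gt0; set x := l2norm u; set y := l2norm v.
set I0 := inner _ _; set a := l2norm (X *m u); set c := l2norm (X *m v).
set L := Lambda_max X m; set l := Lambda_min X m => xy H1 H2.
(* Sum and difference both have squared norm [2 * x ^+ 2 * y ^+ 2]. Subtracting the two bounds
   leaves [4 * x * y] times the inner product, whence the factor 1/2. *)
rewrite -(ler_pM2l xy); move: H1 H2.
move: (n%:R^-1) => N.
by lra.
Qed.

(** Induction on [m]: a block of the largest values grows by a maximizer of [f] among the remaining
    indices. *)
Lemma top_block (f : 'I_p -> R) (U : {set 'I_p}) m : (m <= #|U|)%N ->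
  exists2 T : {set 'I_p}, T \subset U /\ #|T| = m &
    forall i j, i \in T -> j \in U :\: T -> f j <= f i.
Proof.
elim: m => [_|m IHm mU].
  by exists finset.set0; rewrite ?finset.sub0set ?cards0// => i j; rewrite inE.
have [T [TU Tm] Tf] := IHm (ltnW mU).
have [i0 i0UT] : exists i, i \in U :\: T.
  by apply/set0Pn; rewrite -card_gt0 cardsDS// Tm subn_gt0.
case: (@arg_maxP _ _ _ i0 (mem (U :\: T)) f i0UT) => i /= iUT imax.
have /setDP[iU iT] := iUT.
exists (i |: T)%SET; first by rewrite finset.subUset finset.sub1set iU TU cardsU1 iT Tm.
move=> k l /setU1P[->|kT]; rewrite !inE negb_or => /andP[/andP[li lT] lU].
  by apply: imax; apply/finset.setDP; split.
by apply: Tf; rewrite // inE lT lU.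
Qed.

Lemma top_block_avg (f : 'I_p -> R) (U T : {set 'I_p}) m : (0 < m)%N -> #|T| = m ->
  (forall i j, i \in T -> j \in U :\: T -> f j <= f i) ->
  forall j, j \in U :\: T -> f j <= (\sum_(i in T) f i) / m%:R.
Proof.
move=> m0 Tm Tf j jUT; rewrite ler_pdivlMr ?ltr0n// mulr_natr -Tm -sumr_const.
by apply: ler_sum => i iT; exact: Tf.
Qed.

Lemma l2norm_restr_le (T : {set 'I_p}) (v : 'cV[R]_p) m (M : R) : (#|T| <= m)%N -> 0 <= M ->
  (forall j, j \in T -> `|v j 0| <= M) -> l2norm (restr T v) <= Num.sqrt m%:R * M.
Proof.
move=> Tm M0 vM; rewrite -(@ler_pXn2r _ 2) ?nnegrE ?mulr_ge0 ?l2norm_ge0 ?sqrtr_ge0//.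
rewrite sqr_l2norm_restr exprMn sqr_sqrtr ?ler0n//.
apply: (@le_trans _ _ (#|T|%:R * M ^+ 2)).
  rewrite mulr_natl -sumr_const; apply: ler_sum => j jT.
  by rewrite -(real_normK (num_real (v j 0))) lerXn2r ?nnegrE ?vM.
by rewrite ler_wpM2r ?sqr_ge0// ler_nat.
Qed.

(* Induction on |U|: once the m largest coordinates of v are peeled off, the rest
   are bounded by their average, which turns sqrt m * M into an l1 norm. *)
Lemma inner_shelling m m' (W : {set 'I_p}) (w v : 'cV[R]_p) : (0 < m)%N -> 0 <= theta X m m' ->
  (#|W| <= m')%N -> supp w \subset W ->
  forall (U : {set 'I_p}) M, [disjoint U & W]%B -> 0 <= M ->
  (forall j, j \in U -> `|v j 0| <= M) ->
  `|inner (X *m restr U v) (X *m w)| / n%:R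
    <= theta X m m' * (Num.sqrt m%:R * M + (\sum_(j in U) `|v j 0|) / Num.sqrt m%:R)
       * l2norm w.
Proof.
move=> m0 th0 Wm wW U; move: {2}#|U| (leqnn #|U|) => k.
have sm0 : 0 < Num.sqrt m%:R :> R by rewrite sqrtr_gt0 ltr0n.
have thw0 : 0 <= theta X m m' * l2norm w by rewrite mulr_ge0 ?l2norm_ge0.
have block (T : {set 'I_p}) (M : R) : [disjoint T & W]%B -> 0 <= M -> (#|T| <= m)%N ->
    (forall j, j \in T -> `|v j 0| <= M) ->
    `|inner (X *m restr T v) (X *m w)| / n%:R
      <= theta X m m' * (Num.sqrt m%:R * M) * l2norm w.
  move=> TW M0 Tm vM; apply: le_trans (inner_le_theta TW Tm Wm (supp_restr T v) wW) _.
  by rewrite ler_wpM2r ?l2norm_ge0// ler_wpM2l// l2norm_restr_le.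
elim: k U => [|k IHk] U Uk M UW M0 vM;
  have [Um|mU] := leqP #|U| m.
- apply: le_trans (block _ _ UW M0 Um vM) _; rewrite ler_wpM2r ?l2norm_ge0// ler_wpM2l//.
  by rewrite lerDl divr_ge0 ?sumr_ge0 ?ltW.
- by move: Uk mU; rewrite leqn0 => /eqP ->.
- apply: le_trans (block _ _ UW M0 Um vM) _; rewrite ler_wpM2r ?l2norm_ge0// ler_wpM2l//.
  by rewrite lerDl divr_ge0 ?sumr_ge0 ?ltW.
have [T [TU Tm] Tf] := top_block (fun j => `|v j 0|) (ltnW mU).
have Tavg := top_block_avg m0 Tm Tf.
have UT : U = (T :|: (U :\: T))%SET by rewrite -{1}(finset.setID U T) (finset.setIidPr TU).
have TUT : [disjoint T & U :\: T]%B.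
  rewrite disjoint_sym finset.disjoints_subset; apply/fintype.subsetP => j.
  by rewrite !inE => /andP[].
have TW : [disjoint T & W]%B := disjointWl TU UW.
have UTW : [disjoint U :\: T & W]%B := disjointWl (finset.subsetDl U T) UW.
set sT := \sum_(i in T) `|v i 0| in Tavg.
have sT0 : 0 <= sT by apply: sumr_ge0.
have UTk : (#|U :\: T| <= k)%N.
  by rewrite -ltnS (leq_trans _ Uk)// cardsDS// Tm -{2}(subnK (ltnW mU)) -addn1 leq_add2l.
have := IHk _ UTk (sT / m%:R) UTW (divr_ge0 sT0 (ler0n _ _)) Tavg.
have := block T M TW M0 (eq_leq Tm) (fun j jT => vM j (fintype.subsetP TU j jT)).
have -> : \sum_(j in U) `|v j 0| = sT + \sum_(j in U :\: T) `|v j 0|.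
  by rewrite (finset.big_setID T) (finset.setIidPr TU).
rewrite {3}UT restrU// mulmxDr innerDl.
have -> : Num.sqrt m%:R * (sT / m%:R) = sT / Num.sqrt m%:R.
  rewrite -{2}(sqr_sqrtr (ler0n R m)); field; exact: lt0r_neq0.
set i1 := inner _ _; set i2 := inner _ _ => H1 H2.
apply: le_trans (_ : (`|i1| + `|i2|) / n%:R <= _).
  by rewrite ler_pM2r ?invr_gt0// ler_normD.
by rewrite mulrDl; apply: le_trans (lerD H1 H2) _; lra.
Qed.

End DesignConstants.

(** * Error bounds for the Lasso *)

Section LassoError.
Context {R : realType} {n p : nat}.
Variable X : 'M[R]_(n, p).
Hypothesis n_gt0 : (0 < n)%N.

Let nR_gt0 : 0 < n%:R :> R.
Proof. by rewrite ltr0n. Qed.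

(** Hölder's inequality once [X] is moved onto the noise: the event bounds the sup norm of X^T e /
    n. *)
Lemma inner_noise_le (e : 'cV[R]_n) tau (T : {set 'I_p}) (u : 'cV[R]_p) :
  noise_event X tau e -> supp u \subset T ->
  inner (X *m u) e / n%:R <= tau * \sum_(j in T) `|u j 0|.
Proof.
move=> eP /supp_sub uT; rewrite inner_mulmxl mulrC -innerZr innerE.
rewrite (bigID (mem T))/= [X in _ + X]big1 ?addr0; last by move=> j /uT ->; rewrite mul0r.
rewrite mulr_sumr; apply: ler_sum => j _.
by rewrite (le_trans (ler_norm _))// normrM mulrC ler_wpM2r// eP.
Qed.

(** The objective at [b] is compared with its value at [restr T beta] rather than at [beta], so that
    the coordinates off [T] enter as the bias [delta]. *)
Lemma lasso_basic_ineq (beta b : 'cV[R]_p) (e : 'cV[R]_n) tau lambda_n (T : {set 'I_p}) :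
  0 <= lambda_n -> 2 * tau <= lambda_n -> noise_event X tau e ->
  is_lasso X (X *m beta + e) lambda_n b ->
  let h := b - restr T beta in let delta := restr (~: T) beta in
  l2norm (X *m (h - delta)) ^+ 2 / n%:R + lambda_n * \sum_(j in ~: T) `|h j 0|
    <= l2norm (X *m delta) ^+ 2 / n%:R + 3 * lambda_n * \sum_(j in T) `|h j 0|.
Proof.
move=> ln0 tau_ln eP bP /=; set h := b - restr T beta; set delta := restr (~: T) beta.
have := bP (restr T beta); rewrite /lasso_obj.
have betaE : beta = restr T beta + delta := restrC T beta.
have -> : X *m beta + e - X *m b = e - (X *m h - X *m delta).
  by rewrite {1}betaE /h mulmxDr mulmxBr; apply/colP => i; rewrite !mxE; lra.
have -> : X *m beta + e - X *m restr T beta = X *m delta + e.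
  by rewrite {1}betaE mulmxDr; apply/colP => i; rewrite !mxE; lra.
(* On [T] this is the triangle inequality; off [T] the vector [restr T beta] vanishes and [h] equals
   [b]. *)
have l1_le : l1norm (restr T beta) - l1norm b
    <= \sum_(j in T) `|h j 0| - \sum_(j in ~: T) `|h j 0|.
  rewrite /l1norm -sumrB [X in _ <= X - _]big_mkcond [X in _ <= _ - X]big_mkcond -sumrB.
  apply: ler_sum => j _; rewrite /h !mxE inE; case: ifP => _ /=.
    by rewrite subr0 distrC lerB_dist.
  by rewrite normr0 subr0.
have hE : \sum_j `|h j 0| = \sum_(j in T) `|h j 0| + \sum_(j in ~: T) `|h j 0|.
  rewrite (bigID (mem T))/=; congr (_ + _).
  by apply: eq_bigl => j; rewrite inE.
have noise : inner (X *m h) e / n%:R <= tau * \sum_j `|h j 0|.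
  have -> : \sum_j `|h j 0| = \sum_(j in [set: 'I_p]%SET) `|h j 0|.
    by apply: eq_bigl => j; rewrite finset.in_setT.
  exact: inner_noise_le eP (finset.subsetT _).
clearbody h delta.
move: noise; rewrite hE mulmxBr.
set x := \sum_(j in T) _ in l1_le *; set y := \sum_(j in ~: T) _ in l1_le *.
have x0 : 0 <= x by apply: sumr_ge0.
have y0 : 0 <= y by apply: sumr_ge0.
have expand1 (x' d : 'cV[R]_n) : inner (e - (x' - d)) (e - (x' - d))
    = inner e e - 2 * inner x' e + 2 * inner d e + inner (x' - d) (x' - d).
  rewrite !(innerDr, innerDl, innerNr, innerNl).
  by rewrite (innerC e x') (innerC e d) (innerC d x'); lra.
have expand2 (d : 'cV[R]_n) : inner (d + e) (d + e) = inner d d + 2 * inner d e + inner e e.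
  by rewrite !(innerDr, innerDl) (innerC e d); lra.
rewrite invfM !sqr_l2norm expand1 expand2.
move: (inner _ _) (inner _ _) (inner _ _) (inner _ _) (inner _ _).
move: (n%:R^-1) => N.
set l := lambda_n in ln0 tau_ln *.
set l1 := l1norm _ in l1_le *; set l2 := l1norm _ in l1_le *.
move=> a1 a2 a3 a4 a5 H1 H2.
(* Twice the noise term costs at most [l * (x + y)]. Added to the doubled penalty gain, at most
   [2 * l * (x - y)], it leaves [3 * l * x - l * y]. *)
have H3 : tau * (x + y) *+ 2 <= l * (x + y) by rewrite -mulr_natl mulrA ler_wpM2r ?addr_ge0.
have H4 := ler_wpM2l ln0 l1_le.
by lra.
Qed.

(** Let [W] be [T] together with up to [m] largest coordinates of [h] off [T]. Pairing
    [X *m restr W h] with [X *m h], and bounding the remainder by [inner_shelling], gives a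
    quadratic inequality in the norm of [X *m restr W h]; [Lambda_min] at level [2 * m] passes from
    that norm to the one of [restr W h]. *)
Lemma l2norm_restr_shelling m (T : {set 'I_p}) (h : 'cV[R]_p) :
  (1 < p)%N -> (0 < m)%N -> (#|T| <= m)%N -> 0 < Lambda_min X (2 * m) ->
  l2norm (restr T h)
    <= l2norm (X *m h) / Num.sqrt n%:R / Num.sqrt (Lambda_min X (2 * m))
       + theta X m (2 * m) * ((\sum_(j in ~: T) `|h j 0|) / Num.sqrt m%:R)
         / Lambda_min X (2 * m).
Proof.
move=> p1 m0 Tm lam0.
have th0 : 0 <= theta X m (2 * m) by apply: theta_ge0; rewrite ?muln_gt0.
have sm0 : 0 < Num.sqrt m%:R :> R by rewrite sqrtr_gt0 ltr0n.
have sn0 : 0 < Num.sqrt n%:R :> R by rewrite sqrtr_gt0 ltr0n.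
(* [M] bounds [h] beyond [T1]: it is 0 if [T1] is the whole complement of [T], and otherwise the
   average over [T1]. *)
have [T1 [T1U T1m] [M [M0 hM sM]]] : exists2 T1 : {set 'I_p},
    T1 \subset ~: T /\ (#|T1| <= m)%N & exists M : R, [/\ 0 <= M,
    forall j, j \in ~: T :\: T1 -> `|h j 0| <= M &
    Num.sqrt m%:R * M <= (\sum_(j in T1) `|h j 0|) / Num.sqrt m%:R].
  have [Um|mU] := leqP #|~: T| m.
    exists (~: T)%SET; first by rewrite subxx.
    exists 0; split=> // [j|]; first by rewrite finset.setDv inE.
    by rewrite mulr0 divr_ge0 ?sumr_ge0 ?ltW.
  have [T1 [T1U T1m] T1f] := top_block (fun j => `|h j 0|) (ltnW mU).
  exists T1; first by rewrite T1m.
  exists ((\sum_(j in T1) `|h j 0|) / m%:R); split.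
  - by rewrite divr_ge0 ?sumr_ge0.
  - exact: top_block_avg T1f.
  rewrite le_eqVlt; apply/orP; left; apply/eqP.
  rewrite -{2}(sqr_sqrtr (ler0n R m)); field; exact: lt0r_neq0.
pose W := (T :|: T1)%SET; pose U := (~: T :\: T1)%SET.
have WU : ~: W = U by rewrite /U /W finset.setCU finset.setDE.
have Wm : (#|W| <= 2 * m)%N.
  by rewrite mul2n -addnn (leq_trans (leq_card_setU _ _))// leq_add.
have UW : [disjoint U & W]%B by rewrite finset.disjoints_subset WU.
have := inner_shelling n_gt0 m0 th0 Wm (supp_restr W h) UW M0 hM.
have hE : X *m restr U h = X *m h - X *m restr W h.
  by rewrite {2}(restrC W h) WU mulmxDr addrAC subrr add0r.
rewrite hE innerBl -sqr_l2norm => shell.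
(* The l1 norm over [T1] pays for [M], so with the one over [U] it adds up to the l1 norm off
   [T]. *)
have Uy : Num.sqrt m%:R * M + (\sum_(j in U) `|h j 0|) / Num.sqrt m%:R
    <= (\sum_(j in ~: T) `|h j 0|) / Num.sqrt m%:R.
  by rewrite [in leRHS](finset.big_setID T1) (finset.setIidPr T1U) mulrDl lerD2r.
have TW := l2norm_restr_sub h (finset.subsetUl T T1).
apply: le_trans TW _; rewrite -/W.
have lamW : Lambda_min X (2 * m) * l2norm (restr W h) ^+ 2
    <= l2norm (X *m restr W h) ^+ 2 / n%:R.
  apply: l2norm_mulmx_ge_Lambda_min => //.
  exact: leq_trans (subset_leq_card (supp_restr _ _)) Wm.
have cs := cauchy_schwarz (X *m h) (X *m restr W h).
set ell := Num.sqrt (Lambda_min X (2 * m)).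
have ell0 : 0 < ell by rewrite sqrtr_gt0.
have ell2 : Lambda_min X (2 * m) = ell ^+ 2 by rewrite sqr_sqrtr ?ltW.
have nE : n%:R = Num.sqrt n%:R ^+ 2 :> R by rewrite sqr_sqrtr.
rewrite ell2 in lamW *; rewrite nE in lamW shell.
set z := l2norm (X *m h) / Num.sqrt n%:R.
pose om := l2norm (X *m restr W h) / Num.sqrt n%:R.
set r := l2norm (restr W h) in shell lamW *.
set Y := (\sum_(j in ~: T) _) / _ in Uy *.
have r0 : 0 <= r := l2norm_ge0 _.
have om0 : 0 <= om by rewrite divr_ge0 ?l2norm_ge0 ?ltW.
have lamW' : ell * r <= om.
  have er0 : 0 <= ell * r by rewrite mulr_ge0// ltW.
  by rewrite -(@ler_pXn2r _ 2) ?nnegrE// exprMn expr_div_n.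
have quad : om ^+ 2 <= z * om + theta X m (2 * m) * Y * r.
  have H1 : om ^+ 2 - z * om <= - ((inner (X *m h) (X *m restr W h)
      - l2norm (X *m restr W h) ^+ 2) / Num.sqrt n%:R ^+ 2).
    rewrite /om /z mulrBl opprB expr_div_n lerD2l lerN2 mulrACA -invfM -expr2.
    by rewrite ler_pM2r ?invr_gt0 ?exprn_gt0.
  have H2 : theta X m (2 * m)
        * (Num.sqrt m%:R * M + (\sum_(j in U) `|h j 0|) / Num.sqrt m%:R) * r
      <= theta X m (2 * m) * Y * r by rewrite ler_wpM2r// ler_wpM2l.
  have H3 := ler_norm (- (inner (X *m h) (X *m restr W h) - l2norm (X *m restr W h) ^+ 2)).
  rewrite normrN in H3.
  have : 0 <= (Num.sqrt n%:R ^+ 2)^-1 :> R by rewrite invr_ge0 exprn_ge0// sqrtr_ge0.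
  by move=> /ler_wpM2r/(_ _ _ H3); rewrite mulNr; lra.
have thY0 : 0 <= theta X m (2 * m) * Y by rewrite mulr_ge0// divr_ge0 ?sumr_ge0 ?ltW.
have z0 : 0 <= z by rewrite divr_ge0 ?l2norm_ge0 ?ltW.
clearbody om z r Y.
rewrite -(ler_pM2l ell0); apply: (le_trans lamW').
have -> : ell * (z / ell + theta X m (2 * m) * Y / ell ^+ 2)
    = z + theta X m (2 * m) * Y / ell.
  by field; exact: lt0r_neq0.
(* The inequality [quad] is about to be divided by [om], so the value 0 is treated apart. *)
have [om_eq0|om_neq0] := eqVneq om 0.
  by rewrite om_eq0 addr_ge0// divr_ge0// ltW.
have om_gt0 : 0 < om by rewrite lt_def om_neq0.
have rom : r <= om / ell by rewrite ler_pdivlMr// mulrC.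
rewrite -(ler_pM2r om_gt0) -expr2 mulrDl; apply: le_trans quad _; rewrite lerD2l.
rewrite (_ : _ / ell * om = theta X m (2 * m) * Y * (om / ell)); last by ring.
by rewrite ler_wpM2l.
Qed.

(** Here [tau] stands for [lambda * sigma], and [d0 * tau] is the penalty. Each of the two regimes
    supplies one argument of the maximum in [D0_const]; the cone regime accounts for both terms of
    [D1_const]. *)
Lemma lasso_error s m (T : {set 'I_p}) (h delta : 'cV[R]_p) d0 tau :
  (1 < p)%N -> RE X m 6 -> (#|T| <= m)%N -> 0 < Lambda_min X (2 * m) ->
  (#|supp delta| <= s - m)%N -> l2norm delta ^+ 2 <= m%:R * tau ^+ 2 ->
  0 < tau -> 2 <= d0 ->
  l2norm (X *m (h - delta)) ^+ 2 / n%:R + d0 * tau * \sum_(j in ~: T) `|h j 0|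
    <= l2norm (X *m delta) ^+ 2 / n%:R + 3 * (d0 * tau) * \sum_(j in T) `|h j 0| ->
  \sum_(j in ~: T) `|h j 0| <= D1_const X s m d0 * tau * m%:R /\
  l2norm (restr T h) <= D0_const X s m d0 * tau * Num.sqrt m%:R.
Proof.
move=> p1 REm Tm lam0 dsupp dnorm tau0 d02 basic.
have m0 : (0 < m)%N by case: REm.
have K0 : 0 < RE_const X m 6 by rewrite invr_gt0; case: REm.
have sn0 : 0 < Num.sqrt n%:R :> R by rewrite sqrtr_gt0 ltr0n.
have sm0 : 0 < Num.sqrt m%:R :> R by rewrite sqrtr_gt0 ltr0n.
have nE : n%:R = Num.sqrt n%:R ^+ 2 :> R by rewrite sqr_sqrtr.
have mE : m%:R = Num.sqrt m%:R ^+ 2 :> R by rewrite sqr_sqrtr.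
have Lam0 := Lambda_max_ge0 X n_gt0 (s - m).
have LE : Lambda_max X (s - m) = Num.sqrt (Lambda_max X (s - m)) ^+ 2 by rewrite sqr_sqrtr.
have HB := l2norm_mulmx_le_Lambda_max X n_gt0 dsupp.
have HZ : l2norm (X *m h) / Num.sqrt n%:R
    <= l2norm (X *m (h - delta)) / Num.sqrt n%:R + l2norm (X *m delta) / Num.sqrt n%:R.
  rewrite -mulrDl ler_pM2r ?invr_gt0//.
  by have := l2norm_triangle (X *m (h - delta)) (X *m delta); rewrite -mulmxDr subrK.
have xN : \sum_(j in T) `|h j 0| <= Num.sqrt m%:R * l2norm (restr T h).
  apply: le_trans (ler_l1_l2 T h) _; rewrite ler_wpM2r ?l2norm_ge0// ler_wsqrtr//.
  by rewrite ler_nat.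
have RE_T : \sum_(j in ~: T) `|h j 0| <= 6 * \sum_(j in T) `|h j 0| ->
    l2norm (restr T h) <= RE_const X m 6 * (l2norm (X *m h) / Num.sqrt n%:R).
  by move=> cone; apply: RE_l2norm REm Tm _; rewrite !l1norm_subvec.
have shell := l2norm_restr_shelling h p1 m0 Tm lam0.
have th0 : 0 <= theta X m (2 * m) by apply: theta_ge0; rewrite ?muln_gt0.
have y0 : 0 <= \sum_(j in ~: T) `|h j 0| by apply: sumr_ge0.
have x0 : 0 <= \sum_(j in T) `|h j 0| by apply: sumr_ge0.
have : 0 <= l2norm (X *m (h - delta)) / Num.sqrt n%:R by rewrite divr_ge0 ?l2norm_ge0 ?ltW.
have : 0 <= l2norm (X *m delta) / Num.sqrt n%:R by rewrite divr_ge0 ?l2norm_ge0 ?ltW.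
rewrite nE -!expr_div_n in basic HB; move: basic HB.
move: HZ RE_T xN shell; rewrite /D1_const /D0_const /D_const.
set A := l2norm (X *m (h - delta)) / _; set B := l2norm (X *m delta) / _.
set x := \sum_(j in T) _ in x0 *; set y := \sum_(j in ~: T) _ in y0 *.
set Z := l2norm (X *m h) / _; set N := l2norm (restr T h).
set K := RE_const X m 6 in K0 *; set L := Lambda_max X (s - m) in Lam0 LE *.
set q := Num.sqrt m%:R in sm0 mE *; set sL := Num.sqrt L in LE *.
set l := Lambda_min X (2 * m) in lam0 *; set th := theta X m (2 * m) in th0 *.
move=> HZ RE_T xN shell basic HB B0 A0; clearbody A B x y Z N K L q l th.
have sL0 : 0 <= sL := sqrtr_ge0 _.
have slq0 : 0 <= sL * tau * q by rewrite !mulr_ge0// ltW.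
have B2 : B ^+ 2 <= L * tau ^+ 2 * q ^+ 2.
  by apply: le_trans HB _; rewrite -mE -mulrA ler_wpM2l// mulrC.
have Bq : B <= sL * tau * q.
  by rewrite -(@ler_pXn2r _ 2) ?nnegrE// !exprMn -LE.
have d0_gt0 : 0 < d0 by lra.
have dt0 : 0 < d0 * tau by rewrite mulr_gt0.
have s2_ge1 : 1 <= Num.sqrt 2 :> R.
  by rewrite -(@ler_pXn2r _ 2) ?nnegrE ?sqrtr_ge0// sqr_sqrtr// expr1n ler1n.
have D1E : (2 * L / d0 + 9 * K ^+ 2 * d0 / 2) * tau * q ^+ 2
    = (2 * (L * tau ^+ 2 * q ^+ 2) + 9 / 2 * (d0 * tau * q * K) ^+ 2) / (d0 * tau).
  by field; rewrite !lt0r_neq0.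
rewrite mE D1E; split.
- rewrite ler_pdivlMr// mulrC.
  have [BS|BL] := lerP (B ^+ 2) (3 * (d0 * tau) * x); last first.
    have := sqr_ge0 (d0 * tau * q * K); have := sqr_ge0 A.
    by move=> ? ?; lra.
  have yx : y <= 6 * x by rewrite -(ler_pM2l dt0); have := sqr_ge0 A; lra.
  have NAB : N <= K * (A + B) by apply: le_trans (RE_T yx) _; rewrite ler_pM2l.
  have xAB : d0 * tau * x <= d0 * tau * q * K * (A + B).
    rewrite -!mulrA ler_pM2l// ler_pM2l// (le_trans xN)// ler_pM2l//.
  move: xAB; set u := d0 * tau * q * K => xAB.
  (* The bound on [d0 * tau * y] is [2 * B ^+ 2 - (A ^+ 2 - 3 * u * A) - (B ^+ 2 - 3 * u * B)];
     completing both squares leaves [9 / 2 * u ^+ 2], the second term of [D1_const]. *)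
  have := sqr_ge0 (A - 3 / 2 * u); have := sqr_ge0 (B - 3 / 2 * u).
  by move=> ? ?; lra.
have [BS|BL] := lerP (B ^+ 2) (3 * (d0 * tau) * x).
- have yx : y <= 6 * x by rewrite -(ler_pM2l dt0); have := sqr_ge0 A; lra.
  have NAB : N <= K * (A + B) by apply: le_trans (RE_T yx) _; rewrite ler_pM2l.
  have xAB : d0 * tau * x <= d0 * tau * q * K * (A + B).
    rewrite -!mulrA ler_pM2l// ler_pM2l// (le_trans xN)// ler_pM2l//.
  (* With [u] the product [d0 * tau * q * K], the basic inequality gives
     [A ^+ 2 - B ^+ 2 <= 3 * u * (A + B)], and [A + B] cancels. *)
  have AB : A - B <= 3 * (d0 * tau * q * K).
    have [AB0|AB0] := lerP (A + B) 0.
      have : 0 <= d0 * tau * q * K by rewrite !mulr_ge0 ?ltW.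
      by lra.
    rewrite -(ler_pM2r AB0).
    have := mulr_ge0 (ltW dt0) y0.
    by lra.
  apply: (@le_trans _ _ (K * Num.sqrt 2 * (2 * sL + 3 * d0 * K) * tau * q)); last first.
    by rewrite -!mulrA !mulrA ler_pM2r// ler_pM2r// le_max lexx orbT.
  apply: (@le_trans _ _ (K * ((2 * sL + 3 * d0 * K) * tau * q))).
    by apply: le_trans NAB _; rewrite ler_pM2l//; lra.
  have w0 : 0 <= 2 * sL + 3 * d0 * K by rewrite addr_ge0// !mulr_ge0// ltW.
  by rewrite -!(mulrA K) -!(mulrA (Num.sqrt 2)) ler_pM2l// ler_peMl// !mulr_ge0// ltW.
apply: (@le_trans _ _
  (((Num.sqrt 2 + 1) * (sL / Num.sqrt l) + th * L / l) * tau * q)); last first.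
  by rewrite ler_pM2r// ler_pM2r// le_max lexx.
(* Here [B ^+ 2] dominates: [A <= Num.sqrt 2 * B] turns the triangle inequality into the factor
   [Num.sqrt 2 + 1] of [D_const]. *)
have A2 : A ^+ 2 <= 2 * B ^+ 2 by have := mulr_ge0 (ltW dt0) y0; lra.
have AB : A <= Num.sqrt 2 * B.
  by rewrite -(@ler_pXn2r _ 2) ?nnegrE ?mulr_ge0 ?sqrtr_ge0// exprMn sqr_sqrtr.
(* [d0 >= 2] absorbs the factor 2 of [d0 * tau * y <= 2 * B ^+ 2], which keeps [d0] out of the
   [theta] term. *)
have yq : y / q <= L * tau * q.
  rewrite ler_pdivrMr// -(ler_pM2l dt0).
  apply: (@le_trans _ _ (2 * B ^+ 2)); first by have := sqr_ge0 A; lra.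
  apply: (@le_trans _ _ (2 * (L * tau ^+ 2 * q ^+ 2))); first by rewrite ler_pM2l.
  rewrite (_ : d0 * tau * _ = d0 * (L * tau ^+ 2 * q ^+ 2)); last by ring.
  by rewrite ler_wpM2r// LE -!exprMn sqr_ge0.
have Zq : Z <= (Num.sqrt 2 + 1) * sL * tau * q.
  apply: le_trans HZ _; apply: (@le_trans _ _ ((Num.sqrt 2 + 1) * B)); first by lra.
  by rewrite -!mulrA ler_wpM2l ?addr_ge0 ?sqrtr_ge0// !mulrA.
apply: le_trans shell _.
have sl0 : 0 < Num.sqrt l by rewrite sqrtr_gt0.
rewrite (mulrDl _ _ tau) (mulrDl _ _ q); apply: lerD.
  have -> : (Num.sqrt 2 + 1) * (sL / Num.sqrt l) * tau * q
    = (Num.sqrt 2 + 1) * sL * tau * q / Num.sqrt l by ring.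
  by rewrite ler_pM2r ?invr_gt0.
have -> : th * L / l * tau * q = th * (L * tau * q) / l by ring.
by rewrite ler_pM2r ?invr_gt0// ler_wpM2l.
Qed.

End LassoError.

(** * Initial segments of the index set *)

Section FirstCoords.
Variable p : nat.
Implicit Types (A : {set 'I_p}) (m : nat).

Lemma card_first_coords m : (m <= p)%N -> #|first_coords m : {set 'I_p}| = m.
Proof.
move=> mp; rewrite -sum1_card -[RHS]card_ord -sum1_card.
rewrite (big_ord_widen p (fun=> 1%N) mp); apply: eq_bigl => j.
by rewrite inE.
Qed.

(** A down-closed set is an initial segment, so only cardinalities matter: an index [j < m] missing
    from [A] would confine [A] to the first [j] indices. *)
Lemma first_coords_sub A m : (forall i j : 'I_p, (i <= j)%N -> j \in A -> i \in A) ->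
  (m <= #|A|)%N -> first_coords m \subset A.
Proof.
move=> Adown mA; apply/fintype.subsetP => j; rewrite inE => jm; apply/negPn/negP => jA.
have : (#|A| <= #|first_coords j : {set 'I_p}|)%N.
  apply/subset_leq_card/fintype.subsetP => i iA; rewrite inE ltnNge.
  by apply: contra jA => ji; exact: Adown iA.
by rewrite card_first_coords ?(ltnW (ltn_ord j))// leqNgt (leq_trans jm).
Qed.

Lemma sub_first_coords A m : (forall i j : 'I_p, (i <= j)%N -> j \in A -> i \in A) ->
  (#|A| <= m)%N -> A \subset first_coords m.
Proof.
move=> Adown Am; apply/fintype.subsetP => j jA; rewrite inE ltnNge; apply/negP => mj.
(* Together with [j], the set [A] contains the first [j.+1] indices, more than [m] allows. *)
have : (#|first_coords j.+1 : {set 'I_p}| <= #|A|)%N.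
  apply/subset_leq_card/fintype.subsetP => i; rewrite inE ltnS => ij.
  exact: Adown jA.
by rewrite card_first_coords ?ltn_ord// leqNgt ltnS (leq_trans Am).
Qed.

End FirstCoords.

(** * Effective sparsity of the signal *)

Section Sparsity.
Context {R : realType} {p : nat}.
Variables (beta : 'cV[R]_p) (tau : R).
Implicit Types m : nat.

Lemma le_beta_min (A : {set 'I_p}) (x : R) j :
  (x%:E <= beta_min beta A)%E -> j \in A -> x <= `|beta j 0|.
Proof.
by move=> xA jA; rewrite -lee_fin; apply: le_trans xA _; exact: bigmin_le_cond.
Qed.

(** In the sum of [sparsity_bound] a large coordinate contributes exactly [tau ^+ 2] and any other
    one its own square; the large ones are then subtracted. *)
Lemma sum_sqr_small_coords m : 0 <= tau -> sparsity_bound beta tau m ->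
  \sum_(j in ~: large_coords beta tau) beta j 0 ^+ 2
    <= (m%:R - #|large_coords beta tau|%:R) * tau ^+ 2.
Proof.
move=> tau0; rewrite /sparsity_bound (bigID (mem (large_coords beta tau)))/=.
rewrite mulrBl lerBrDl; apply: le_trans; apply: lerD.
  rewrite mulr_natl -sumr_const; apply: ler_sum => j; rewrite inE => tauj.
  rewrite le_min lexx andbT -(real_normK (num_real (beta j 0))).
  by rewrite lerXn2r ?nnegrE// ltW.
rewrite le_eqVlt; apply/orP; left; apply/eqP.
apply: eq_big => j; first by rewrite !inE.
rewrite !inE -leNgt => jtau; apply/esym/min_idPl.
by rewrite -(real_normK (num_real (beta j 0))) lerXn2r ?nnegrE.
Qed.

Lemma card_large_coords m : 0 < tau -> sparsity_bound beta tau m ->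
  (#|large_coords beta tau| <= m)%N.
Proof.
move=> tau0 /(sum_sqr_small_coords (ltW tau0)) H; rewrite -(ler_nat R) -subr_ge0.
rewrite -(pmulr_lge0 _ (exprn_gt0 2 tau0)).
by apply: le_trans H; apply: sumr_ge0 => j _; exact: sqr_ge0.
Qed.

(** Minimality of [s0] turns this into [s0 <= s]. *)
Lemma sparsity_bound_supp : sparsity_bound beta tau #|supp beta|.
Proof.
rewrite /sparsity_bound (bigID (mem (supp beta)))/= [X in _ + X]big1 ?addr0.
  by rewrite mulr_natl -sumr_const; apply: ler_sum => j _; rewrite ge_min lexx orbT.
by move=> j; rewrite inE negbK => /eqP ->; rewrite expr0n; apply/min_idPl/sqr_ge0.
Qed.

End Sparsity.

(** * Least squares on a selected set of columns *)

Section LeastSquares.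
Context {R : realType} {n p : nat}.
Variable X : 'M[R]_(n, p).
Variable I : {set 'I_p}.
Hypothesis n_gt0 : (0 < n)%N.
Hypothesis Lambda_min_gt0 : 0 < Lambda_min X #|I|.

Let nR_gt0 : 0 < n%:R :> R.
Proof. by rewrite ltr0n. Qed.

Lemma l2norm_mulmx_supp (u : 'cV[R]_p) : supp u \subset I ->
  Lambda_min X #|I| * l2norm u ^+ 2 <= l2norm (X *m u) ^+ 2 / n%:R.
Proof. by move=> uI; apply: l2norm_mulmx_ge_Lambda_min => //; exact: subset_leq_card. Qed.

(** A kernel vector of the Gram matrix is mapped to 0 by the columns in [I], so positivity of
    [Lambda_min] makes it vanish. *)
Lemma gram_unit : (subcols X I)^T *m subcols X I \in unitmx.
Proof.
rewrite -row_free_unit; apply: inj_row_free => v vG.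
have Xc0 : l2norm (X *m extend0 v^T) ^+ 2 = 0.
  by rewrite sqr_l2norm extend0E inner_mulmxl mulmxA /inner mulmxA trmxK vG mul0mx mxE.
have := l2norm_mulmx_supp (supp_extend0 v^T).
rewrite Xc0 mul0r l2norm_extend0 pmulr_rle0// => v0.
have /eqP : l2norm v^T == 0 by rewrite -sqrf_eq0 eq_le v0 sqr_ge0.
by move=> /eqP; rewrite l2norm_eq0 => /eqP/(congr1 trmx); rewrite trmxK trmx0.
Qed.

Lemma supp_ols (Y : 'cV[R]_n) : supp (ols X I Y) \subset I.
Proof. exact: supp_extend0. Qed.

Lemma olsD (Y Z : 'cV[R]_n) : ols X I (Y + Z) = ols X I Y + ols X I Z.
Proof. by rewrite /ols /extend0 !mulmxDr. Qed.

(** The normal equations. Besides these, only the support and the additivity of [ols] are used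
    below. *)
Lemma ols_normal (Y : 'cV[R]_n) (u : 'cV[R]_p) : supp u \subset I ->
  inner (X *m u) (X *m ols X I Y) = inner (X *m u) Y.
Proof.
move=> uI; rewrite -[u](restr_id uI) -extend0_subvec /ols !extend0E !inner_mulmxl.
by rewrite !mulmxA mulmxV ?gram_unit// mul1mx.
Qed.

(** One factor [l2norm u] cancels between the quadratic lower bound and the linear upper bound. *)
Lemma l2norm_le_of_quad (u : 'cV[R]_p) (c : R) : supp u \subset I -> 0 <= c ->
  l2norm (X *m u) ^+ 2 / n%:R <= c * l2norm u ->
  Lambda_min X #|I| * l2norm u <= c.
Proof.
move=> uI c0 H; have [->|u0] := eqVneq u 0; first by rewrite l2norm0 mulr0.
rewrite -(@ler_pM2r _ (l2norm u)) ?l2norm_gt0// -mulrA -expr2.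
exact: le_trans (l2norm_mulmx_supp uI) H.
Qed.

Lemma inner_noise_le_l2 (e : 'cV[R]_n) tau (u : 'cV[R]_p) : 0 <= tau ->
  noise_event X tau e -> supp u \subset I ->
  inner (X *m u) e / n%:R <= Num.sqrt #|I|%:R * tau * l2norm u.
Proof.
move=> tau0 eP uI; apply: le_trans (inner_noise_le eP uI) _.
rewrite mulrAC mulrC ler_wpM2r//.
by have := ler_l1_l2 I u; rewrite restr_id.
Qed.

(** For [u] the error on [I], the normal equations express the squared norm of [X *m u] as its inner
    product with the omitted signal plus its inner product with the noise; each is linear in
    [l2norm u]. *)
Lemma ols_l2_error (beta : 'cV[R]_p) (e : 'cV[R]_n) tau m :
  0 <= tau -> noise_event X tau e -> (#|I :|: supp beta| <= m)%N ->
  Lambda_min X m <= Lambda_max X m ->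
  Lambda_min X #|I| * l2norm (ols X I (X *m beta + e) - restr I beta)
    <= (Lambda_max X m - Lambda_min X m) / 2 * l2norm (restr (~: I) beta)
       + Num.sqrt #|I|%:R * tau.
Proof.
move=> tau0 eP Im gap0; set u := ols _ _ _ - _.
have uI : supp u \subset I by rewrite supp_subD ?supp_ols ?supp_subN ?supp_restr.
have gap : 0 <= (Lambda_max X m - Lambda_min X m) / 2 by rewrite divr_ge0// subr_ge0.
apply: l2norm_le_of_quad => //.
  by rewrite addr_ge0// mulr_ge0// ?l2norm_ge0 ?sqrtr_ge0.
have -> : l2norm (X *m u) ^+ 2 = inner (X *m u) (X *m restr (~: I) beta) + inner (X *m u) e.
  have uE : X *m u = X *m ols X I (X *m beta + e) - X *m restr I beta.
    by rewrite /u mulmxBr.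
  clearbody u; rewrite sqr_l2norm {2}uE innerBr ols_normal// {1}(restrC I beta).
  by rewrite mulmxDr !innerDr; lra.
rewrite (mulrDl _ _ n%:R^-1) (mulrDl _ _ (l2norm u)) lerD ?inner_noise_le_l2//.
rewrite -mulrA (mulrC (l2norm _)).
(* Cutting the complement of [I] down to the support of [beta] keeps the union within [m]
   coordinates. *)
apply: (@inner_le_Lambda_gap _ _ _ _ n_gt0 _ I (~: I :&: supp beta)) => //.
- rewrite finset.disjoints_subset finset.setCI finset.setCK finset.subsetUl//.
- apply: leq_trans Im; apply/subset_leq_card/finset.setUS/finset.subsetIr.
- exact: supp_restrI.
Qed.

(** Pythagoras: the two parts of the error are supported in [I] and in its complement. *)
Lemma sqr_l2norm_ols (beta : 'cV[R]_p) (Y : 'cV[R]_n) :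
  l2norm (ols X I Y - beta) ^+ 2
    = l2norm (ols X I Y - restr I beta) ^+ 2 + l2norm (restr (~: I) beta) ^+ 2.
Proof.
have -> : ols X I Y - beta = ols X I Y - restr I beta - restr (~: I) beta.
  by rewrite {1}(restrC I beta) opprD addrA.
set g := _ - restr I beta; set d := restr (~: I) beta.
have gd0 : inner g d = 0.
  apply: (@inner_disjoint _ _ _ _ I (~: I)).
  - by rewrite supp_subD ?supp_ols ?supp_subN ?supp_restr.
  - exact: supp_restr.
  - by rewrite finset.disjoints_subset finset.setCK.
by clearbody g d; rewrite !sqr_l2norm innerBl !innerBr (innerC d g) gd0; lra.
Qed.

(** The noiseless fit is the orthogonal projection of [X *m beta] on the span of the columns in [I],
    and [X *m restr I beta] lies in that span. *)
Lemma ols_bias (beta : 'cV[R]_p) :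
  l2norm (X *m ols X I (X *m beta) - X *m beta) <= l2norm (X *m restr (~: I) beta).
Proof.
set r := X *m _ - _.
have rE : l2norm r ^+ 2 = - inner r (X *m restr (~: I) beta).
  have rorth u : supp u \subset I -> inner r (X *m u) = 0.
    by move=> uI; rewrite innerC /r innerBr ols_normal// subrr.
  have rE : r = X *m ols X I (X *m beta) - X *m restr I beta - X *m restr (~: I) beta.
    by rewrite /r -addrA -opprD -mulmxDr -restrC.
  clearbody r; rewrite sqr_l2norm {2}rE !innerBr.
  by rewrite (rorth (ols _ _ _)) ?(rorth (restr I _)) ?supp_ols ?supp_restr// subr0 sub0r.
have [r0|r0] := eqVneq (l2norm r) 0; first by rewrite r0 l2norm_ge0.
rewrite -(@ler_pM2l _ (l2norm r)) ?lt_def ?r0 ?l2norm_ge0// -expr2 rE.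
by apply: le_trans (ler_norm _) _; rewrite normrN ler_norm_inner.
Qed.

(** Additivity of [ols] splits the error into the bias of the noiseless fit and the fit to pure
    noise, which [Lambda_max] controls at the levels of [supp beta] and [I]. *)
Lemma ols_prediction_error (beta : 'cV[R]_p) (e : 'cV[R]_n) tau :
  0 <= tau -> noise_event X tau e ->
  l2norm (X *m ols X I (X *m beta + e) - X *m beta) / Num.sqrt n%:R
    <= Num.sqrt (Lambda_max X #|supp beta|) * l2norm (restr (~: I) beta)
       + Num.sqrt (Lambda_max X #|I|) * (Num.sqrt #|I|%:R * tau / Lambda_min X #|I|).
Proof.
move=> tau0 eP.
have sn0 : 0 < Num.sqrt n%:R :> R by rewrite sqrtr_gt0.
have sqrtX m (u : 'cV[R]_p) : (#|supp u| <= m)%N ->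
    l2norm (X *m u) / Num.sqrt n%:R <= Num.sqrt (Lambda_max X m) * l2norm u.
  move=> um; rewrite -(@ler_pXn2r _ 2) ?nnegrE ?divr_ge0 ?mulr_ge0 ?l2norm_ge0 ?sqrtr_ge0//.
  rewrite expr_div_n exprMn (@sqr_sqrtr _ n%:R)// (@sqr_sqrtr _ (Lambda_max X m)) ?Lambda_max_ge0//.
  exact: l2norm_mulmx_le_Lambda_max.
have -> : X *m ols X I (X *m beta + e) - X *m beta
    = (X *m ols X I (X *m beta) - X *m beta) + X *m ols X I e.
  by rewrite olsD mulmxDr addrAC.
apply: (@le_trans _ _ (l2norm (X *m restr (~: I) beta) / Num.sqrt n%:R
    + l2norm (X *m ols X I e) / Num.sqrt n%:R)).
  rewrite -mulrDl ler_pM2r ?invr_gt0//; apply: le_trans (l2norm_triangle _ _) _.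
  by rewrite lerD2r ols_bias.
apply: lerD.
  apply: sqrtX; apply/subset_leq_card/(fintype.subset_trans (supp_restrI _ _)).
  exact: finset.subsetIr.
apply: le_trans (sqrtX #|I| _ _) _; first exact/subset_leq_card/supp_ols.
rewrite ler_wpM2l ?sqrtr_ge0// ler_pdivlMr// mulrC.
apply: l2norm_le_of_quad; rewrite ?supp_ols ?mulr_ge0 ?sqrtr_ge0//.
by rewrite sqr_l2norm ols_normal ?supp_ols// inner_noise_le_l2 ?supp_ols.
Qed.

End LeastSquares.

(** * Selection by thresholding, followed by the least squares refit *)

Theorem theorem6p3 (R : realType) (d : measure_display)
    (Omega : measurableType d) (P : probability Omega R)
    (n p : nat) (X : 'M[R]_(n, p)) (beta : 'cV[R]_p) (sigma : R)
    (eps : Omega -> 'cV[R]_n) (s0 : nat)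
    (a b lambda_n d0 D1' t0 : R) (beta_init : Omega -> 'cV[R]_p) :
  let Y w := X *m beta + eps w in
  let lambda := Num.sqrt (2 * ln p%:R / n%:R) in
  let lambda_sap := sigma * Num.sqrt (1 + a) * Num.sqrt (2 * ln p%:R / n%:R) in
  let S := supp beta in
  let s := #|S| in
  let T0 := first_coords s0 in
  let A0 := large_coords beta (lambda * sigma) in
  let a0 := #|A0| in
  let D0 := D0_const X s s0 d0 in
  let D1 := D1_const X s s0 d0 in
  (0 < n)%N -> (n <= p)%N ->
  (forall j, l2norm (col j X) = Num.sqrt n%:R) ->
  0 < sigma -> gaussian_noise P sigma eps ->
  (forall i j : 'I_p, (i <= j)%N -> `|beta j 0| <= `|beta i 0|) ->
  is_s0 beta (lambda * sigma) s0 ->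
  RE X s0 6 ->
  0 < Lambda_min X (2 * s) -> has_ubound (sparse_rayleigh X (2 * s)) ->
  0 <= a -> 2 <= b -> b * lambda_sap <= lambda_n ->
  lambda_n = d0 * lambda * sigma ->
  (forall w, is_lasso X (Y w) lambda_n (beta_init w)) ->
  D1 <= D1' ->
  ((D0 * lambda * sigma * Num.sqrt s0%:R + D1' * lambda * sigma)%:E
     <= beta_min beta A0)%E ->
  D1' * lambda * sigma <= t0 ->
  forall w, eps w \in noise_event X lambda_sap ->
  let I := threshold_set (beta_init w) t0 in
  let betahat := ols X I (Y w) in
  [/\ (#|I :&: ~: T0| <= s0)%N,
      (#|I| <= 2 * s0)%N &
      (* t0 must not exceed beta_min - D0 lambda sigma sqrt s0: a larger
         threshold can discard coordinates of A0 *)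
      ((D0 * lambda * sigma * Num.sqrt s0%:R + t0)%:E <= beta_min beta A0)%E ->
      [/\ A0 \subset I,
          l2norm (subvec (~: I) beta) ^+ 2
            <= (s0%:R - a0%:R) * lambda ^+ 2 * sigma ^+ 2,
          exists2 C7 : R,
            C7 <= Lambda_min X #|I| ^+ 2
                  + (Lambda_max X (2 * s) - Lambda_min X (2 * s)) ^+ 2 / 2
                  + 4 * (1 + a) &
            l2norm (betahat - beta) ^+ 2
              <= C7 * s0%:R * lambda ^+ 2 * sigma ^+ 2 / Lambda_min X #|I| ^+ 2 &
          let C8 := Num.sqrt (Lambda_max X s)
                    + Num.sqrt (2 * (1 + a) * Lambda_max X #|I|)
                      / Lambda_min X #|I| in
          l2norm (X *m betahat - X *m beta) / Num.sqrt n%:R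
            <= C8 * Num.sqrt s0%:R * lambda * sigma]].
Proof.
move=> Y lambda lambda_sap S s T0 A0 a0 D0 D1 n_gt0 np _ sigma_gt0 _ beta_sorted
  s0P REs0 lam_gt0 _ a_ge0 b_ge2 b_le lambda_nE lassoP D1_le _ t0_ge w.
rewrite inE => noise I betahat.
have tauE : lambda_sap = Num.sqrt (1 + a) * (lambda * sigma).
  by rewrite /lambda_sap /lambda; ring.
have {s0P} [s0_bound s0_min] := s0P.
have s0_gt0 : (0 < s0)%N by case: REs0.
(* If [lambda] were 0, level 0 would satisfy the sparsity bound and force [s0 = 0], against [RE]. *)
have lambda_gt0 : 0 < lambda.
  rewrite lt_def sqrtr_ge0 andbT; apply: contraTneq s0_gt0 => lambda0.
  rewrite -leqNgt; apply: s0_min; rewrite /sparsity_bound lambda0 !mul0r expr0n /= ?mulr0.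
  by apply: sumr_le0 => j _; rewrite ge_min lexx orbT.
have p_gt1 : (1 < p)%N.
  rewrite ltnNge; apply/negP => p_le1; move: lambda_gt0.
  have p1 : p = 1%N by apply/eqP; rewrite eqn_leq p_le1 (leq_trans n_gt0 np).
  by rewrite /lambda p1 ln1 mulr0 mul0r sqrtr0 ltxx.
clearbody lambda.
set tau := lambda * sigma in tauE s0_bound s0_min *.
have tau_gt0 : 0 < tau by rewrite mulr_gt0.
have sap_ge : tau <= lambda_sap.
  rewrite tauE ler_peMl ?(ltW tau_gt0)// -(@ler_pXn2r _ 2) ?nnegrE ?sqrtr_ge0//.
  by rewrite expr1n sqr_sqrtr ?addr_ge0// lerDl.
have sap_ge0 : 0 <= lambda_sap := le_trans (ltW tau_gt0) sap_ge.
have sap2_le : 2 * lambda_sap <= lambda_n by apply: le_trans b_le; rewrite ler_wpM2r.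
have lambda_n_tau : lambda_n = d0 * tau by rewrite lambda_nE mulrA.
(* The chain is [d0 * tau = lambda_n >= 2 * lambda_sap >= 2 * tau]. *)
have d0_ge2 : 2 <= d0 by rewrite -(ler_pM2r tau_gt0); lra.
have large_T0 : A0 \subset T0.
  apply: sub_first_coords; last exact: card_large_coords s0_bound.
  by move=> i j ij; rewrite !inE => /lt_le_trans; apply; exact: beta_sorted.
have s0_le_s : (s0 <= s)%N by apply: s0_min; exact: sparsity_bound_supp.
have T0_supp : T0 \subset supp beta.
  apply: first_coords_sub s0_le_s => i j ij; rewrite !inE -!normr_gt0 => /lt_le_trans.
  by apply; exact: beta_sorted.
have card_T0 : #|T0| = s0.
  apply: card_first_coords; apply: leq_trans s0_le_s _.
  by rewrite -[X in (_ <= X)%N]card_ord max_card.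
have small_le := sum_sqr_small_coords (ltW tau_gt0) s0_bound.
have sub_small (D : {set 'I_p}) : D \subset ~: A0 ->
    l2norm (restr D beta) ^+ 2 <= (s0%:R - a0%:R) * tau ^+ 2.
  move=> DA0; rewrite sqr_l2norm_restr; apply: le_trans small_le.
  rewrite [leRHS](finset.big_setID D) (finset.setIidPr DA0) lerDl.
  by apply: sumr_ge0 => j _; exact: sqr_ge0.
have s0a0_le : (s0%:R - a0%:R) * tau ^+ 2 <= s0%:R * tau ^+ 2.
  by rewrite ler_wpM2r ?sqr_ge0// gerBl.
have p_gt0 := ltnW p_gt1.
(* Monotonicity applies since [2 * s0 <= 2 * s]; the case [m = 0], where the default value is 1,
   covers an empty [I]. *)
have lam_pos m : (m <= 2 * s0)%N -> 0 < Lambda_min X m.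
  move=> ms0; have [->|m_gt0] := posnP m; first by rewrite /Lambda_min eqxx.
  apply: lt_le_trans lam_gt0 _; apply: Lambda_min_mono => //.
  by rewrite m_gt0 (leq_trans ms0)// leq_mul2l s0_le_s.
pose delta := restr (~: T0) beta; pose h := beta_init w - restr T0 beta.
have delta_supp : (#|supp delta| <= s - s0)%N.
  rewrite -card_T0 -cardsDS//; apply/subset_leq_card/(fintype.subset_trans (supp_restrI _ _)).
  by rewrite finset.setIC finset.setDE.
have delta_norm : l2norm delta ^+ 2 <= s0%:R * tau ^+ 2.
  by apply: le_trans s0a0_le; apply: sub_small; rewrite finset.setCS.
have lambda_n_ge0 : 0 <= lambda_n by apply: le_trans sap2_le; rewrite mulr_ge0.
have basic := lasso_basic_ineq T0 lambda_n_ge0 sap2_le noise (lassoP w).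
rewrite /= -/h -/delta lambda_n_tau in basic.
have [h_off h_on] := lasso_error n_gt0 p_gt1 REs0 (eq_leq card_T0) (lam_pos _ (leqnn _))
  delta_supp delta_norm tau_gt0 d0_ge2 basic.
rewrite -/s -/D0 -/D1 in h_off h_on.
have K_gt0 : 0 < RE_const X s0 6 by rewrite invr_gt0; case: REs0.
have D1_gt0 : 0 < D1.
  have d0_gt0 : 0 < d0 by lra.
  rewrite /D1 /D1_const ltr_wpDl ?divr_ge0 ?(ltW d0_gt0) ?mulr_ge0 ?Lambda_max_ge0//.
  by rewrite !mulr_gt0 ?K_gt0 ?invr_gt0 ?ltr0n.
have t0_ge' : D1 * tau <= t0.
  by apply: le_trans t0_ge; rewrite -(mulrA D1') ler_wpM2r// ltW.
have t0_gt0 : 0 < t0 by apply: lt_le_trans t0_ge'; rewrite mulr_gt0.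
(* A counting argument: each index of [I] off [T0] contributes at least [t0] to the l1 norm of [h]
   there, which is at most [t0 * s0]. *)
have I_off : (#|I :&: ~: T0| <= s0)%N.
  rewrite -(ler_nat R) -(ler_pM2r t0_gt0).
  apply: (@le_trans _ _ (\sum_(j in ~: T0) `|h j 0|)).
    rewrite mulr_natl -sumr_const [leRHS](finset.big_setID I) finset.setIC/=.
    rewrite ler_wpDr ?sumr_ge0//; apply: ler_sum => j; rewrite !inE /h !mxE => /andP[jT].
    by rewrite inE (negPf jT) subr0.
  by apply: le_trans h_off _; rewrite mulrC ler_wpM2l.
have I_card : (#|I| <= 2 * s0)%N.
  rewrite -(finset.cardsID T0 I) mul2n -addnn leq_add//.
    by rewrite -[X in (_ <= X)%N]card_T0 subset_leq_card// finset.subsetIr.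
  by rewrite finset.setDE.
split=> // beta_min_ge.
(* A coordinate of [h] on [T0] is at most the l2 norm there, hence at most
   [D0 * tau * Num.sqrt s0%:R]; what is left of the signal still reaches [t0]. *)
have A0I : A0 \subset I.
  apply/fintype.subsetP => j jA0; have jT0 := fintype.subsetP large_T0 j jA0.
  have := le_beta_min beta_min_ge jA0.
  have := le_trans (ler_coord_l2norm (restr T0 h) j) h_on.
  rewrite inE mxE jT0 /h !mxE jT0 -mulrA => hj bj.
  have := lerB_dist (beta j 0) (beta_init w j 0); rewrite distrC /tau in hj *.
  by rewrite mulrA in hj; lra.
have lamI := lam_pos _ I_card.
pose betaD := l2norm (restr (~: I) beta).
have betaD_le : betaD ^+ 2 <= (s0%:R - a0%:R) * tau ^+ 2.
  by apply: sub_small; rewrite finset.setCS.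
have betaD_le' : betaD ^+ 2 <= s0%:R * tau ^+ 2 := le_trans betaD_le s0a0_le.
have lambda_sigma2 : lambda ^+ 2 * sigma ^+ 2 = tau ^+ 2 by rewrite -exprMn.
(* As [T0] lies in the support, only the part of [I] off [T0] is new, and it has at most [s0 <= s]
   elements. *)
have card_IS : (#|I :|: supp beta| <= 2 * s)%N.
  have -> : I :|: supp beta = (I :&: ~: T0) :|: supp beta.
    apply/setP => j; rewrite !inE; have := fintype.subsetP T0_supp j.
    rewrite !inE; case: (j < s0)%N => /=; last by rewrite andbT.
    by move=> /(_ isT) ->; rewrite !orbT.
  rewrite mul2n -addnn (leq_trans (leq_card_setU _ _))// leq_add//.
  exact: leq_trans I_off s0_le_s.
have gap_ge0 : Lambda_min X (2 * s) <= Lambda_max X (2 * s).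
  apply: Lambda_min_le_max => //; rewrite muln_gt0/=.
  exact: leq_trans s0_gt0 s0_le_s.
have l2_err := ols_l2_error n_gt0 lamI sap_ge0 noise card_IS gap_ge0.
have pred_err := ols_prediction_error n_gt0 lamI beta sap_ge0 noise.
have noise_I : (Num.sqrt #|I|%:R * lambda_sap) ^+ 2 <= 2 * (1 + a) * (s0%:R * tau ^+ 2).
  rewrite tauE -/tau (exprMn 2 (Num.sqrt _) (_ * tau)) (exprMn 2 _ tau) !sqr_sqrtr ?addr_ge0//.
  have : #|I|%:R <= 2 * s0%:R :> R by rewrite -natrM ler_nat.
  have w0 : 0 <= (1 + a) * tau ^+ 2 by rewrite mulr_ge0 ?addr_ge0 ?sqr_ge0.
  by move=> /(ler_wpM2r w0); lra.
split=> //.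
- by rewrite l2norm_subvec -mulrA lambda_sigma2.
- exists (Lambda_min X #|I| ^+ 2 + (Lambda_max X (2 * s) - Lambda_min X (2 * s)) ^+ 2 / 2
          + 4 * (1 + a)) => //.
  rewrite /betahat sqr_l2norm_ols -/betaD ler_pdivlMr ?exprn_gt0//.
  rewrite -(mulrA _ (lambda ^+ 2)) lambda_sigma2 -(mulrA _ s0%:R).
  move: l2_err; rewrite -/betaD.
  set u := l2norm _; set v := _ * lambda_sap in noise_I *.
  have u0 : 0 <= u := l2norm_ge0 _.
  have v0 : 0 <= v by rewrite mulr_ge0 ?sqrtr_ge0.
  have b0 : 0 <= betaD := l2norm_ge0 _.
  set g := _ - _ in gap_ge0 * => l2_err.
  have g0 : 0 <= g by rewrite subr_ge0.
  have l2_err2 : (Lambda_min X #|I| * u) ^+ 2 <= (g / 2 * betaD + v) ^+ 2.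
    rewrite ler_pXn2r// nnegrE; first by rewrite mulr_ge0// ltW.
    by rewrite addr_ge0// mulr_ge0// divr_ge0.
  have := ler_wpM2l (sqr_ge0 g) betaD_le'.
  have := ler_wpM2l (sqr_ge0 (Lambda_min X #|I|)) betaD_le'.
  (* The square of [g / 2 * betaD + v] is at most twice the sum of the squares, giving [g ^+ 2 / 2]
     and, through [noise_I], [4 * (1 + a)]. *)
  have := sqr_ge0 (g / 2 * betaD - v).
  clearbody u v g betaD.
  move: (Lambda_min X #|I|) (s0%:R * tau ^+ 2) l2_err2 noise_I => m z.
  by lra.
have st_ge0 : 0 <= Num.sqrt s0%:R * tau := mulr_ge0 (sqrtr_ge0 _) (ltW tau_gt0).
have betaD_le_sqrt : betaD <= Num.sqrt s0%:R * tau.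
  rewrite -(@ler_pXn2r _ 2) ?nnegrE ?st_ge0 ?l2norm_ge0//.
  by rewrite (exprMn 2 _ tau) (sqr_sqrtr (ler0n _ s0)).
have a2_ge0 : 0 <= 2 * (1 + a) by rewrite mulr_ge0 ?addr_ge0.
have noise_I_sqrt : Num.sqrt #|I|%:R * lambda_sap
    <= Num.sqrt (2 * (1 + a)) * (Num.sqrt s0%:R * tau).
  rewrite -(@ler_pXn2r _ 2) ?nnegrE ?(mulr_ge0 _ st_ge0) ?(mulr_ge0 _ sap_ge0) ?sqrtr_ge0//.
  rewrite [leRHS](exprMn 2 (Num.sqrt _) (_ * tau)) (exprMn 2 (Num.sqrt s0%:R)).
  by rewrite (sqr_sqrtr a2_ge0) (sqr_sqrtr (ler0n _ s0)).
move=> /=; apply: (le_trans pred_err).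
rewrite -(mulrA _ lambda) -/tau -(mulrA _ _ tau) [leRHS]mulrDl; apply: lerD.
  by rewrite ler_wpM2l ?sqrtr_ge0.
rewrite [leRHS](_ : _ = Num.sqrt (Lambda_max X #|I|)
  * (Num.sqrt (2 * (1 + a)) * (Num.sqrt s0%:R * tau) / Lambda_min X #|I|)).
  by rewrite ler_wpM2l ?sqrtr_ge0// ler_pM2r ?invr_gt0.
by rewrite sqrtrM//; ring.
Qed.
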